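(* Let $J\in\{[0,\infty),\mathbb{R}\}$, let $X$ be a real Banach space and let $E=X\oplus iX$ be its complexification. Let $\mathfrak{g}(t)=e^{it^2}$ for $t\in\mathbb{R}$. Let $f:J\to E$ be a function such that $\Delta_s f\in\mathfrak{g}\,UC(J,E)$ for each $s>0$. Then: (i) $f\in\mathfrak{g}\,BUC(J,E)+\Delta C_0(J,E)$ and $\Delta_s f\in\mathfrak{g}\,BUC(J,E)$ for each $s>0$. (ii) $M_hf\in\Delta C_0(J,E)$ for each $h>0$. (iii) Each of the spaces $\mathfrak{g}\,BUC(J,E)$ and $\mathfrak{g}\,UC(J,E)$ has $(\Delta)$.
   Context: $E=X\oplus iX$ is the complex linear space with multiplication $(a+ib)(y_1+iy_2)=(ay_1-by_2)+i(by_1+ay_2)$, endowed with the (product) topology of the norm $\|y_1+iy_2\|=\max\{\|y_1\|,\|y_2\|\}$ (or any of the equivalent norms $(\|y_1\|^p+\|y_2\|^p)^{1/p}$, $1\le p<\infty$). For $f:J\to E$ and $s>0$, $(\Delta_s f)(t)=f(t+s)-f(t)$. For $f\in L^1_{loc}(J,E)$ and $h>0$, $M_hf(t)=\frac1h\int_0^h f(t+s)\,ds$, $t\in J$. $UC(J,E)$, $BUC(J,E)$, $C_0(J,E)$ denote the spaces of uniformly continuous (not necessarily bounded), bounded uniformly continuous, and continuous vanishing at infinity functions $J\to E$; $\mathfrak{g}\,\mathcal{U}=\{\mathfrak{g}u:u\in\mathcal{U}\}$; $\Delta C_0(J,E)=\{\phi\in L^1_{loc}(J,E): \Delta_h\phi\in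 C_0(J,E)\text{ for all }h>0\}$. A class $\mathcal{A}\subset L^1_{loc}(J,E)$ has (satisfies) $(\Delta)$ if for every $f\in L^1_{loc}(J,E)$ with $\Delta_s f\in\mathcal{A}$ for all $s>0$ one has $f-M_hf\in\mathcal{A}$ for all $h>0$. *)

(* Defs.v *)
From HB Require Import structures.
From mathcomp Require Import all_boot all_order all_algebra.
From mathcomp Require Import all_classical all_reals all_analysis.
From mathcomp Require Import complex.

Set Implicit Arguments.
Unset Strict Implicit.
Unset Printing Implicit Defensive.

Import Order.TTheory GRing.Theory Num.Theory.
Import numFieldNormedType.Exports.

Local Open Scope classical_set_scope.
Local Open Scope ring_scope.

(* The complexification E = X (+) iX of a real Banach space X is carried by
   X * X, the pair (y1, y2) standing for y1 + i y2.  The canonical norm of the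
   library on X * X is max(|y1|, |y2|). *)
Section Complexification.
Context {R : realType} {X : normedModType R}.
Implicit Types (z : R[i]) (y : X * X).

Definition cscale z y : X * X :=
  (complex.Re z *: y.1 - complex.Im z *: y.2,
   complex.Im z *: y.1 + complex.Re z *: y.2).

Lemma cscale1 y : cscale 1 y = y.
Proof.
by case: y => a b; rewrite /cscale /= !scale1r !scale0r subr0 add0r.
Qed.

Lemma cscaleA z w y : cscale z (cscale w y) = cscale (z * w) y.
Proof.
case: z w y => [a b] [c d] [u v]; rewrite /cscale /=; congr pair.
  by rewrite scalerBr scalerDr !scalerA scalerBl scalerDl !opprD addrACA.
by rewrite scalerBr scalerDr !scalerA scalerBl scalerDl addrC addrACA.
Qed.

Lemma cscaleDr z y1 y2 : cscale z (y1 + y2) = cscale z y1 + cscale z y2.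
Proof.
case: z y1 y2 => [a b] [u v] [w x]; rewrite /cscale /=; congr pair.
  by rewrite !scalerDr opprD addrACA.
by rewrite !scalerDr addrACA.
Qed.

Lemma cscaleDl z1 z2 y : cscale (z1 + z2) y = cscale z1 y + cscale z2 y.
Proof.
case: z1 z2 y => [a b] [c d] [u v]; rewrite /cscale /=; congr pair.
  by rewrite !scalerDl opprD addrACA.
by rewrite !scalerDl addrACA.
Qed.

End Complexification.

(* Bochner integral over the compact interval [a, b], for Lebesgue measure. *)
Section Bochner.
Context {R : realType} {V : normedModType R}.
Implicit Types (a b : R) (f s : R -> V).

Definition simple_function s :=
  finite_set (range s) /\
  forall v, measurable (s @^-1` [set v] : set (measurableTypeR R)).

Definition simple_integral a b s : V :=
  \sum_(v \in range s)
    fine (lebesgue_measure (`[a, b] `&` s @^-1` [set v])) *: v.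

Definition bochner_approx a b f (s : nat -> R -> V) :=
  [/\ forall n, simple_function (s n),
      {ae (@lebesgue_measure R),
         forall x, x \in `[a, b] -> s n x @[n --> \oo] --> f x} &
      (\int[@lebesgue_measure R]_(x in `[a, b]) (`|f x - s n x|%:E))%E
        @[n --> \oo] --> 0%E].

Definition bochner_integrable a b f :=
  exists s : nat -> R -> V, bochner_approx a b f s.

Definition is_bochner_integral a b f (I : V) :=
  exists2 s : nat -> R -> V, bochner_approx a b f s &
             simple_integral a b (s n) @[n --> \oo] --> I.

Definition bochner_integral a b f : V :=
  xget 0 [set I | is_bochner_integral a b f I].

End Bochner.

(* A function J -> V is represented by a function R -> V; only its values on J
   are ever constrained.  Here J is [0, oo) or R, so that J + s is a subset of
   J for all s >= 0. *)
Section FunctionSpaces.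
Context {R : realType} {V : normedModType R}.
Implicit Types (J : set R) (f : R -> V).

Definition Delta (s : R) f : R -> V := fun t => f (t + s) - f t.

Definition L1loc J : set (R -> V) :=
  [set f | forall a b : R, a <= b -> `[a, b] `<=` J -> bochner_integrable a b f].

Definition Mean (h : R) f : R -> V :=
  fun t => h^-1 *: bochner_integral 0 h (fun s => f (t + s)).

Definition UC J : set (R -> V) :=
  [set f | forall e : R, 0 < e -> exists2 d : R, 0 < d &
     forall x y, J x -> J y -> `|x - y| < d -> `|f x - f y| < e].

Definition BUC J : set (R -> V) :=
  [set f | UC J f /\ exists M : R, forall t, J t -> `|f t| <= M].

Definition C0 J : set (R -> V) :=
  [set f | {within J, continuous f} /\
     forall e : R, 0 < e -> exists T : R,
       forall t, J t -> T <= `|t| -> `|f t| < e].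

Definition DeltaC0 J : set (R -> V) :=
  [set f | L1loc J f /\ forall h : R, 0 < h -> C0 J (Delta h f)].

Definition sum_space J (A B : set (R -> V)) : set (R -> V) :=
  [set f | exists phi psi, [/\ A phi, B psi &
             forall t, J t -> f t = phi t + psi t]].

Definition has_Delta J (A : set (R -> V)) :=
  A `<=` L1loc J /\
  forall f, L1loc J f -> (forall s : R, 0 < s -> A (Delta s f)) ->
    forall h : R, 0 < h -> A (fun t => f t - Mean h f t).

End FunctionSpaces.

Section Chirp.
Context {R : realType} {X : normedModType R}.

(* e^{i t^2} *)
Definition chirp (t : R) : R[i] := (cos (t ^+ 2) +i* sin (t ^+ 2))%C.

Definition mul_space (J : set R) (g : R -> R[i]) (U : set (R -> X * X)) :
    set (R -> X * X) :=
  [set f | exists2 u, U u & forall t, J t -> f t = cscale (g t) (u t)].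

End Chirp.

(* Main.v *)
(* Write u_s for e^{-it^2} times the difference of f by s.  The cocycle identity
   u_{s+r}(t) = u_r(t) + e^{i(2rt+r^2)} u_s(t+r) forces the uniformly continuous
   functions u_s to be bounded: for r = 1 the phase changes sign between t and
   t + pi/2, whereas u_s and u_{s+1} - u_1 change by a bounded amount.
   By the Baire category theorem the u_s with a common bound and a common
   eps-modulus of continuity are dense near some s; comparing two nearby points
   t, t' with t'^2 - t^2 = pi, where e^{it^2} changes sign, this yields the
   continuity of f, which is not assumed to be measurable, and then uniform
   estimates on u_s for s in compact intervals.  Hence f - M_h f, which is
   - e^{it^2} times the mean of u_s over [0, h], lies in chirp * BUC.  Finally
   the differences of M_h f are uniformly continuous and lie in chirp * BUC, so
   they vanish at infinity by the same sign change. *)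
Require Import Defs.
From mathcomp Require Import all_boot all_order all_algebra.
From mathcomp Require Import all_classical all_reals all_analysis.
From mathcomp Require Import measurable_realfun complex lra ring zify.
(* The library's charge.v exports another cscale. *)
Import Defs.
Import Order.TTheory GRing.Theory Num.Theory.
Import numFieldNormedType.Exports.
Local Open Scope classical_set_scope.
Local Open Scope ring_scope.

(** * Bochner integrals of continuous functions *)

Section Integration.
Set Implicit Arguments.
Unset Strict Implicit.
Context {R : realType}.
Notation mu := (@lebesgue_measure R).
Implicit Types (a b e h : R).

(** The integral of a nonnegative function is a supremum over the simple functions below it, hence
    monotone. This is applied to integrands such as [|f - s n|] with [f] arbitrary. *)
Lemma ge0_le_integral_nonmeasurable (D : set R) (f g : R -> \bar R) :
    (forall x, D x -> 0 <= f x)%E -> (forall x, D x -> f x <= g x)%E ->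
  (\int[mu]_(x in D) f x <= \int[mu]_(x in D) g x)%E.
Proof.
move=> f0 fg; rewrite !ge0_integralE//; last first.
  by move=> x Dx; exact: le_trans (f0 _ Dx) (fg _ Dx).
apply: le_ereal_sup => _ [u /= uf <-]; exists u => // x.
by apply: (le_trans (uf x)); exact: lee_restrict.
Qed.

(** * Maps with finitely many values and measurable fibers *)

Section Fibers.
Context {T : choiceType} (p : R -> T).
Hypotheses (finp : finite_set (range p))
  (mp : forall q, measurable (p @^-1` [set q] : set (measurableTypeR R))).

Lemma measurable_preimage_finite_range (Y : set T) :
  measurable (p @^-1` Y : set (measurableTypeR R)).
Proof.
have -> : p @^-1` Y = \bigcup_(q in range p `&` Y) p @^-1` [set q].
  rewrite eqEsubset; split=> [x Yx|x [q [_ Yq]] /= pxq].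
    by exists (p x) => //; split=> //; exists x.
  by rewrite pxq.
apply: fin_bigcup_measurable; last by move=> q _; exact: mp.
exact: finite_setIl.
Qed.

Lemma lebesgue_measure_fiber_lty a b (Y : set T) :
  (mu (`[a, b]%classic `&` p @^-1` Y) < +oo)%E.
Proof.
apply: (@le_lt_trans _ _ (mu `[a, b]%classic)).
  apply: le_measure; rewrite ?inE//=.
  by apply: measurableI => //; exact: measurable_preimage_finite_range.
by rewrite lebesgue_measure_itv/=; case: ifP => //; rewrite -EFinB ltry.
Qed.

Lemma fine_measure_fibers a b (Y : set T) :
  fine (mu (`[a, b]%classic `&` p @^-1` Y)) =
  \sum_(q \in range p `&` Y) fine (mu (`[a, b]%classic `&` p @^-1` [set q])).
Proof.
have finY : finite_set (range p `&` Y) by exact: finite_setIl.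
apply: EFin_inj; rewrite fineK; last first.
  by rewrite ge0_fin_numE; [exact: lebesgue_measure_fiber_lty|exact: measure_ge0].
rewrite -fsumEFin//.
have -> : `[a, b]%classic `&` p @^-1` Y =
    \bigcup_(q in range p `&` Y) (`[a, b]%classic `&` p @^-1` [set q]).
  rewrite eqEsubset; split=> [x [Ix Yx]|x [q [_ Yq]] [Ix /= pxq]].
    by exists (p x) => //; split=> //; exists x.
  by split=> //=; rewrite pxq.
rewrite measure_fin_bigcup//; last 2 first.
- by move=> q q' _ _ [x [[_ <-] [_ <-]]].
- by move=> q _; apply: measurableI => //; exact: mp.
apply: eq_fsbigr => q _; rewrite fineK// ge0_fin_numE ?measure_ge0//.
exact: lebesgue_measure_fiber_lty.
Qed.

(** The fibers of [phi \o p] are unions of fibers of [p], so the integral can be computed on a finer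
    partition: a common one for two simple functions, or the cells of a grid. *)
Lemma simple_integral_comp {V : normedModType R} a b (phi : T -> V) :
  simple_integral a b (phi \o p) =
  \sum_(q \in range p)
    fine (mu (`[a, b]%classic `&` p @^-1` [set q])) *: phi q.
Proof.
have phip : range (phi \o p) = phi @` range p by rewrite image_comp.
rewrite /simple_integral phip [RHS]fsbig_finite// (finmap.partition_big_imfset _ phi).
rewrite [LHS]fsbig_finite; last exact: finite_image.
rewrite fset_set_image//=; apply: eq_bigr => v _.
rewrite comp_preimage (fine_measure_fibers a b) fsbig_mkcondr fsbig_finite//.
rewrite scaler_suml [RHS]big_mkcond; apply: eq_bigr => q _.
have -> : (q \in phi @^-1` [set v]) = (phi q == v).
  by apply/idP/eqP; rewrite inE.
by case: eqP => [->//|_]; rewrite scale0r.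
Qed.

(** The function [psi \o p] is measurable, so its integral is the sum over the fibers; the
    comparison with the arbitrary [g] is then monotonicity of the integral. *)
Lemma sum_measure_fibers_le_integral a b (psi : T -> R) (g : R -> \bar R) :
    (forall q, 0 <= psi q) ->
    (forall x, `[a, b]%classic x -> ((psi (p x))%:E <= g x)%E) ->
  ((\sum_(q \in range p)
      fine (mu (`[a, b]%classic `&` p @^-1` [set q])) * psi q)%:E <=
   \int[mu]_(x in `[a, b]) g x)%E.
Proof.
move=> psi0 psig.
apply: (@le_trans _ _ (\int[mu]_(x in `[a, b]) (psi (p x))%:E)%E); last first.
  by apply: ge0_le_integral_nonmeasurable => // x _; rewrite lee_fin.
have Ep : `[a, b]%classic = \big[setU/set0]_(q <- finmap.enum_fset (fset_set (range p)))
    (`[a, b]%classic `&` p @^-1` [set q]).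
  rewrite -bigcup_seq eqEsubset; split=> [x Ix|x [q _ []]//].
  by exists (p x) => //=; rewrite in_fset_set// inE; exists x.
rewrite [in leRHS]Ep ge0_integral_bigsetU; last 5 first.
- by move=> q; apply: measurableI => //; exact: mp.
- exact: finmap.fset_uniq.
- by move=> q q' _ _ [x [[_ <-] [_ <-]]].
- apply/measurable_EFinP => _ Y mY.
  apply: measurableI => //.
    rewrite -Ep; exact: measurable_itv.
  rewrite -[X in measurable X]/((psi \o p) @^-1` Y) comp_preimage.
  exact: measurable_preimage_finite_range.
- by move=> x _; rewrite lee_fin.
rewrite fsbig_finite// -sumEFin; apply: lee_sum => q _.
rewrite (@eq_integral _ _ _ _ _ (cst (psi q)%:E)); last first.
  by move=> x; rewrite inE => -[_ ->].
rewrite integral_cst; last by apply: measurableI => //; exact: mp.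
rewrite EFinM muleC fineK// ge0_fin_numE ?measure_ge0//.
exact: lebesgue_measure_fiber_lty.
Qed.

End Fibers.
Lemma fine_lebesgue_measure_itvcc a b : a <= b -> fine (mu `[a, b]%classic) = b - a.
Proof.
move=> ab; rewrite lebesgue_measure_itv/= lte_fin.
by move: ab; rewrite le_eqVlt => /predU1P[->|->]//; rewrite ltxx subrr.
Qed.

Context {V : normedModType R}.
Implicit Types (f s : R -> V).

(* Only the integrand built from the simple functions is measurable, hence the
   detour through the positive part of |s - s'| - e, which lies below |f - s|. *)
Lemma simple_integral_dist a b e f s s' : a <= b -> 0 <= e ->
    simple_function s -> simple_function s' ->
    (forall x, `[a, b]%classic x -> `|f x - s' x| <= e) ->
  (`|simple_integral a b s - simple_integral a b s'|%:E <=
   \int[mu]_(x in `[a, b]) `|f x - s x|%:E + (e * (b - a))%:E)%E.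
Proof.
move=> ab e0 [fs ms] [fs' ms'] fs'e.
(* The pair of values refines both partitions, so that both integrals become sums over the same
   fibers. *)
pose p x := (s x, s' x).
have finp : finite_set (range p).
  apply: (@sub_finite_set _ _ (range s `*` range s')); last exact: finite_setX.
  by move=> _ [x _ <-]; split=> /=; exists x.
have mp q : measurable (p @^-1` [set q] : set (measurableTypeR R)).
  have -> : p @^-1` [set q] = s @^-1` [set q.1] `&` s' @^-1` [set q.2].
    rewrite eqEsubset; split=> x /= => [<-//|[]].
    by rewrite /p; case: q => ? ? /= -> ->.
  by apply: measurableI; [exact: ms|exact: ms'].
rewrite -[s]/(fst \o p) -[s']/(snd \o p).
rewrite !simple_integral_comp//.
rewrite !fsbig_finite// -sumrB.
set m := fun q => fine (mu (`[a, b]%classic `&` p @^-1` [set q])).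
have m0 q : 0 <= m q by rewrite /m fine_ge0// measure_ge0.
have summ : \sum_(q <- finmap.enum_fset (fset_set (range p))) m q = b - a.
  rewrite -fsbig_finite// -[in LHS](setIT (range p)) -fine_measure_fibers//.
  by rewrite preimage_setT setIT fine_lebesgue_measure_itvcc.
apply: (@le_trans _ _ (\sum_(q <- finmap.enum_fset (fset_set (range p)))
     m q * Num.max 0 (`|q.1 - q.2| - e) + e * (b - a))%:E); last first.
  rewrite EFinD leeD2r// -fsbig_finite//.
  apply: sum_measure_fibers_le_integral => // [q|x Ix].
    by rewrite le_max lexx.
  rewrite lee_fin ge_max normr_ge0/= lerBlDr.
  rewrite (le_trans (ler_distD (f x) _ _))//.
  by rewrite distrC lerD// fs'e.
rewrite lee_fin -summ mulr_sumr -big_split/=.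
rewrite (le_trans (ler_norm_sum _ _ _))// ler_sum// => q _.
rewrite -scalerBr normrZ ger0_norm ?m0// mulrC [e * _]mulrC -mulrDr mulrC.
by rewrite ler_wpM2l ?m0// -lerBlDr le_max lexx orbT.
Qed.

Definition uniform_on (A : set R) f := forall e, 0 < e -> exists2 d, 0 < d &
  forall x y, A x -> A y -> `|x - y| < d -> `|f x - f y| < e.

(** * Step approximations on uniform grids *)

Definition step_point a b (n : nat) (k : nat) : R := a + k%:R * ((b - a) / n.+1%:R).

(** The cap [n.+1] makes the index finite-valued on the whole line; for [a < b] it is reached inside
    [[a, b]] only at [b]. For [a = b] the division by 0 returns 0, and so does the index. *)
Definition step_index a b (n : nat) (x : R) : nat :=
  minn n.+1 (Num.truncn ((x - a) / ((b - a) / n.+1%:R))).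

Definition step_approx a b f (n : nat) : R -> V :=
  f \o step_point a b n \o step_index a b n.

Lemma finite_range_step_index a b n : finite_set (range (step_index a b n)).
Proof.
apply: (@sub_finite_set _ _ `I_n.+2); last exact: finite_II.
by move=> _ [x _ <-]; rewrite /= ltnS /step_index geq_minl.
Qed.

Lemma measurable_step_index a b n k :
  measurable (step_index a b n @^-1` [set k] : set (measurableTypeR R)).
Proof.
have -> : step_index a b n @^-1` [set k] =
  (fun x : measurableTypeR R => (x - a) / ((b - a) / n.+1%:R)) @^-1`
     ((fun y : R => minn n.+1 (Num.truncn y)) @^-1` [set k]) by [].
rewrite -[X in measurable X]setTI.
have mf : measurable_fun [set: measurableTypeR R]
    (fun x : measurableTypeR R => (x - a) / ((b - a) / n.+1%:R)).
  by apply: measurable_funM => //; apply: measurable_funB.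
apply: mf => //.
(* [Num.truncn] sends negative numbers to 0, so the cell of index 0 extends to -oo; the cap extends
   the cell of index [n.+1] to +oo. *)
have -> : (fun y : R => minn n.+1 (Num.truncn y)) @^-1` [set k] =
   if k == 0%N then `]-oo, 1[%classic else if (k < n.+1)%N then `[k%:R, k.+1%:R[%classic
     else if k == n.+1 then `[n.+1%:R, +oo[%classic else set0.
  rewrite eqEsubset; case: k => [|k] /=.
    split=> y /=; rewrite in_itv/= -(truncn_le_nat y 0);
      by move: (Num.truncn y) => t; lia.
  rewrite ltnS; have [kn|nk] := ltnP k n.
    split=> y /=; rewrite in_itv/= -truncn_le_nat -truncn_gt_nat;
      by move: (Num.truncn y) => t; lia.
  case: eqP => [[->]|kn]; split=> y //=.
  - by rewrite in_itv/= andbT -truncn_gt_nat; move: (Num.truncn y) => t; lia.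
  - by rewrite in_itv/= andbT -truncn_gt_nat; move: (Num.truncn y) => t; lia.
  - by move: (Num.truncn y) => t; lia.
by repeat case: ifP.
Qed.

Lemma simple_function_step_approx a b f n : simple_function (step_approx a b f n).
Proof.
have fin := finite_range_step_index a b n; split.
  have -> : range (step_approx a b f n) =
      (f \o step_point a b n) @` range (step_index a b n) by rewrite image_comp.
  exact: finite_image.
move=> v; rewrite /step_approx comp_preimage.
by apply: measurable_preimage_finite_range => //; exact: measurable_step_index.
Qed.

Lemma fine_measure_sub_singleton (A : set R) b :
  measurable (A : set (measurableTypeR R)) -> A `<=` [set b] -> fine (mu A) = 0.
Proof.
move=> mA Ab; suff -> : mu A = 0%E by [].
apply/eqP; rewrite eq_le measure_ge0 andbT -(lebesgue_measure_set1 b).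
by apply: le_measure => //; rewrite inE.
Qed.

Lemma fine_measure_step_fiber a b n k : a <= b -> (k < n.+1)%N ->
  fine (mu (`[a, b]%classic `&` step_index a b n @^-1` [set k])) =
  (b - a) / n.+1%:R.
Proof.
rewrite le_eqVlt => /predU1P[<- kn|ab kn].
  rewrite subrr mul0r; apply: (@fine_measure_sub_singleton _ a).
    by apply: measurableI => //; exact: measurable_step_index.
  by move=> x [/=]; rewrite in_itv/= -eq_le => /eqP.
set d := (b - a) / n.+1%:R.
have d0 : 0 < d by rewrite divr_gt0// ?subr_gt0.
have nd : n.+1%:R * d = b - a by rewrite mulrC divfK.
have -> : `[a, b]%classic `&` step_index a b n @^-1` [set k] =
    `[a + k%:R * d, a + k.+1%:R * d[%classic.
  have E x : a <= x ->
      (step_index a b n x = k) <-> (a + k%:R * d <= x < a + k.+1%:R * d).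
    move=> ax; rewrite /step_index -/d.
    have xd0 : 0 <= (x - a) / d by rewrite divr_ge0// ?subr_ge0// ltW.
    have <- : (Num.truncn ((x - a) / d) == k) = (a + k%:R * d <= x < a + k.+1%:R * d).
      by rewrite truncn_eq// ler_pdivlMr// ltr_pdivrMr// lerBrDl ltrBlDl.
    by move: (Num.truncn _) => t; lia.
  rewrite eqEsubset; split=> x /=; rewrite !in_itv/=.
    by move=> [/andP[ax xb]] /(E _ ax).
  move=> H; have ax : a <= x.
    by move/andP: H => [H _]; apply: le_trans H; rewrite lerDl mulr_ge0// ltW.
  split; last exact/(E _ ax).
  rewrite ax/=; move/andP: H => [_ /ltW H]; apply: (le_trans H).
  by rewrite -lerBrDl -nd ler_pM2r// ler_nat.
rewrite lebesgue_measure_itv/= lte_fin ltrD2l ltr_pM2r// ltr_nat ltnS leqnn.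
by rewrite /= -natr1; lra.
Qed.

(** Cells of equal length turn the integral into a left Riemann sum; the facts on means are later
    proved for such sums and passed to the limit. *)
Lemma simple_integral_step_approx a b f n : a <= b ->
  simple_integral a b (step_approx a b f n) =
  ((b - a) / n.+1%:R) *: \sum_(0 <= k < n.+1) f (step_point a b n k).
Proof.
move=> ab; rewrite /step_approx.
rewrite simple_integral_comp; first last.
- by move=> q; exact: measurable_step_index.
- exact: finite_range_step_index.
rewrite (fsbig_widen _ `I_n.+2)/=; last 2 first.
- by move=> _ [x _ <-] /=; rewrite ltnS geq_minl.
- move=> k [_ nk] /=; rewrite (_ : _ `&` _ = set0) ?measure0 ?scale0r//.
  by rewrite -subset0 => x [_ /= xk]; apply: nk; exists x.
rewrite -fsbig_ord big_mkord big_ord_recr/= scaler_sumr.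
(* The index [n.+1] occurs in [[a, b]] at most at [b], which is a null set. *)
rewrite [X in _ + X](_ : _ = 0) ?addr0; last first.
  rewrite (@fine_measure_sub_singleton _ b) ?scale0r//.
    by apply: measurableI => //; exact: measurable_step_index.
  move=> x [/=]; rewrite in_itv/= => /andP[ax xb] xn.
  apply/eqP; rewrite eq_le xb/=.
  have [ab'|/eqP] := eqVneq a b; first by rewrite -ab'.
  move/eqP => nab; have d0 : 0 < (b - a) / n.+1%:R.
    by rewrite divr_gt0// subr_gt0 lt_neqAle nab.
  have : (n < Num.truncn ((x - a) / ((b - a) / n.+1%:R)))%N.
    by move: xn; rewrite /step_index; move: (Num.truncn _) => t; lia.
  rewrite truncn_gt_nat ler_pdivlMr// mulrC divfK//; lra.
by apply: eq_bigr => k _; rewrite fine_measure_step_fiber.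
Qed.

Lemma step_pointP a b n x : `[a, b]%classic x ->
  `[a, b]%classic (step_point a b n (step_index a b n x)) /\
  `|x - step_point a b n (step_index a b n x)| <= (b - a) / n.+1%:R.
Proof.
rewrite /= in_itv/= => /andP[ax xb]; rewrite /step_point /step_index in_itv/=.
have [ab|ba] := ltP a b; last first.
  have xa : x = a by apply/eqP; rewrite eq_le ax (le_trans xb).
  have -> : b = a by apply/eqP; rewrite eq_le ba (le_trans ax).
  by rewrite xa subrr !mul0r truncn0 minn0 mulr0 addr0 lexx subrr normr0 lexx.
set d := (b - a) / n.+1%:R.
have d0 : 0 < d by rewrite divr_gt0// ?subr_gt0.
have nd : n.+1%:R * d = b - a by rewrite mulrC divfK.
have /truncn_itv : 0 <= (x - a) / d by rewrite divr_ge0// ?subr_ge0// ltW.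
have : (Num.truncn ((x - a) / d) <= n.+1)%N.
  rewrite truncn_le_nat; apply: (@le_lt_trans _ _ n.+1%:R); last by rewrite ltr_nat.
  by rewrite ler_pdivrMr// nd; lra.
move: (Num.truncn _) => t tn.
have -> : minn n.+1 t = t by lia.
rewrite ler_pdivlMr// ltr_pdivrMr// -natr1 mulrDl mul1r => /andP[H1 H2].
have t0 : 0 <= t%:R * d by rewrite mulr_ge0// ltW.
split; first by apply/andP; split; lra.
by rewrite ger0_norm; lra.
Qed.

Lemma step_approx_unif a b f : uniform_on `[a, b]%classic f ->
  forall e, 0 < e -> \forall n \near \oo, forall x, `[a, b]%classic x ->
    `|f x - step_approx a b f n x| <= e.
Proof.
move=> uf e e0; have [d d0 fd] := uf _ e0.
have : (b - a) / n.+1%:R @[n --> \oo] --> (0 : R).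
  by rewrite -[X in _ --> X](mulr0 (b - a)); apply: cvgMr; exact: cvg_harmonic.
move/cvgrPdist_lt/(_ _ d0); apply: filterS => n.
rewrite sub0r normrN => nd x Ix.
have [I' /le_lt_trans H] := @step_pointP a b n x Ix.
by apply/ltW/fd => //; apply: H; apply: le_lt_trans nd; rewrite ler_norm.
Qed.

Lemma integral_dist_le a b e f s : a <= b -> 0 <= e ->
    (forall x, `[a, b]%classic x -> `|f x - s x| <= e) ->
  (\int[mu]_(x in `[a, b]) `|f x - s x|%:E <= (e * (b - a))%:E)%E.
Proof.
move=> ab e0 fs.
apply: (@le_trans _ _ (\int[mu]_(x in `[a, b]) cst e%:E x)%E).
  apply: ge0_le_integral_nonmeasurable => x Ix; first by rewrite lee_fin.
  by rewrite lee_fin; exact: fs.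
rewrite integral_cst//= EFinM -(fine_lebesgue_measure_itvcc ab) fineK//.
rewrite ge0_fin_numE ?measure_ge0// lebesgue_measure_itv/=.
by case: ifP => //; rewrite -EFinB ltry.
Qed.

Lemma bochner_approx_step a b f : a <= b -> uniform_on `[a, b]%classic f ->
  bochner_approx a b f (step_approx a b f).
Proof.
move=> ab uf; split.
- by move=> n; exact: simple_function_step_approx.
- refine (@aeW _ _ _ _ _ _) => /= x Ix; apply/cvgrPdist_le => e e0.
  have := step_approx_unif uf e0; apply: filterS => n; apply.
  exact: Ix.
- have E n : (0 <= \int[mu]_(x in `[a, b]) `|f x - step_approx a b f n x|%:E)%E.
    by apply: integral_ge0 => x _; rewrite lee_fin.
  apply/fine_cvgP; split.
    have := step_approx_unif uf ltr01; apply: filterS => n H.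
    rewrite ge0_fin_numE//; apply: le_lt_trans (integral_dist_le ab ler01 H) _.
    by rewrite ltry.
  apply/cvgrPdist_le => e e0.
  (* Adding 1 keeps the denominator positive when [a = b]. *)
  have e1 : 0 < e / (b - a + 1) by rewrite divr_gt0//; lra.
  have := step_approx_unif uf e1; apply: filterS => n H.
  rewrite sub0r normrN/= ger0_norm ?fine_ge0//.
  have H1 := integral_dist_le ab (ltW e1) H.
  rewrite -lee_fin fineK; last first.
    by rewrite ge0_fin_numE//; apply: le_lt_trans H1 _; rewrite ltry.
  apply: le_trans H1 _; rewrite lee_fin mulrAC ler_pdivrMr; last lra.
  by rewrite ler_pM2l//; lra.
Qed.

Lemma bochner_integrable_unif a b f : a <= b -> uniform_on `[a, b]%classic f ->
  bochner_integrable a b f.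
Proof.
by move=> ab uf; exists (step_approx a b f); exact: bochner_approx_step.
Qed.

(** By [simple_integral_dist], the integrals of any approximating sequence stay close to those of
    the grid approximations. An integral is therefore unique, and the value picked by [xget], once
    one exists, is the limit of Riemann sums. *)
Lemma is_bochner_integral_lim a b f I : a <= b -> uniform_on `[a, b]%classic f ->
  is_bochner_integral a b f I ->
  simple_integral a b (step_approx a b f n) @[n --> \oo] --> I.
Proof.
move=> ab uf [s [ss _ /fine_cvgP[sfin s0]] sI].
apply/cvgrPdist_le => e e0.
have e3 : 0 < e / 3 by lra.
have e1 : 0 < e / 3 / (b - a + 1) by rewrite divr_gt0//; lra.
have Hs := step_approx_unif uf e1.
move/cvgrPdist_le : s0 => /(_ _ e3) s0.
move/cvgrPdist_le : sI => /(_ _ e3) sI.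
near=> n.
have Hn : forall x, `[a, b]%classic x ->
    `|f x - step_approx a b f n x| <= e / 3 / (b - a + 1) by near: n.
have := simple_integral_dist ab (ltW e1) (ss n) (simple_function_step_approx a b f n) Hn.
have H1 : `|I - simple_integral a b (s n)| <= e / 3 by near: n.
have H2 : `|0 - fine (\int[mu]_(x in `[a, b]) `|f x - s n x|%:E)%E| <= e / 3 by near: n.
have H3 : (\int[mu]_(x in `[a, b]) `|f x - s n x|%:E)%E \is a fin_num by near: n.
rewrite -(fineK H3) -EFinD lee_fin.
move: H2; rewrite sub0r normrN => /(le_trans (ler_norm _)) H2 H4.
have H5 : e / 3 / (b - a + 1) * (b - a) <= e / 3.
  by rewrite -mulrA ler_piMr ?(ltW e3)// mulrC ler_pdivrMr; lra.
rewrite (le_trans (ler_distD (simple_integral a b (s n)) _ _))//; lra.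
Unshelve. all: by end_near. Qed.

Lemma cvg_simple_integral_step a b f : a <= b -> uniform_on `[a, b]%classic f ->
   (exists I, is_bochner_integral a b f I) ->
  simple_integral a b (step_approx a b f n) @[n --> \oo] --> bochner_integral a b f.
Proof.
move=> ab uf exI; apply: is_bochner_integral_lim => //.
exact: (@xgetPex _ 0 [set I | is_bochner_integral a b f I]).
Qed.

Lemma cauchy_step a b f : a <= b -> uniform_on `[a, b]%classic f ->
  forall e, 0 < e -> exists N, forall n m, (N <= n)%N -> (N <= m)%N ->
   `|simple_integral a b (step_approx a b f n) -
     simple_integral a b (step_approx a b f m)| <= e.
Proof.
move=> ab uf e e0.
have e1 : 0 < e / 2 / (b - a + 1) by rewrite divr_gt0//; lra.
have [N _ HN] := step_approx_unif uf e1; exists N => n m /HN Hn /HN Hm.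
rewrite -lee_fin.
apply: le_trans (simple_integral_dist ab (ltW e1)
  (simple_function_step_approx a b f n)
  (simple_function_step_approx a b f m) Hm) _.
apply: le_trans (leeD2r _ (integral_dist_le ab (ltW e1) Hn)) _.
rewrite -EFinD lee_fin.
have H5 : e / 2 / (b - a + 1) * (b - a) <= e / 2.
  rewrite -mulrA ler_piMr//; first lra.
  by rewrite mulrC ler_pdivrMr; lra.
lra.
Qed.

End Integration.

(** * Continuity relative to a set, completeness, Riemann means *)

Section Cont.
Set Implicit Arguments.
Unset Strict Implicit.
Context {R : realType}.

Definition cont_on {V : normedModType R} (J : set R) (f : R -> V) :=
  forall x, J x -> forall e, 0 < e -> exists2 d, 0 < d &
    forall y, J y -> `|x - y| < d -> `|f x - f y| < e.

Lemma cont_on_within {V : normedModType R} (J : set R) (f : R -> V) :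
  cont_on J f -> {within J, continuous f}.
Proof.
move=> cf; rewrite continuous_subspace_in => x /set_mem Jx.
apply/cvgrPdist_lt => e e0; have [d d0 fd] := cf _ Jx _ e0.
rewrite -nbhs_subspace_in//; apply/nbhs_ballP; exists d => //= y xy Jy.
exact: fd.
Qed.

(** Heine-Cantor, from the near-covering form of compactness: a [d] that serves all points near each
    given point yields one [d] for the whole segment. *)
Lemma cont_on_uniform {V : normedModType R} (J : set R) (f : R -> V) a b :
  `[a, b]%classic `<=` J -> cont_on J f -> uniform_on `[a, b]%classic f.
Proof.
move=> abJ cf e e0.
have cov := (compact_near_coveringP _).1 (@segment_compact R a b).
have H : forall x, `[a, b]%classic x -> \forall x' \near x & d \near (0 : R)^'+,
   forall y, `[a, b]%classic y -> `|x' - y| < d -> `[a, b]%classic x' -> `|f x' - f y| < e.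
  move=> x Ix; have [d d0 fd] := cf _ (abJ _ Ix) _ (divr_gt0 e0 (ltr0n R 2)).
  have d2 : 0 < d / 2 by lra.
  exists (ball x (d / 2), [set y | y < d / 2]).
    split; first exact: nbhsx_ballx.
    exact: nbhs_right_lt.
  move=> [x' d'] [/= xx' dd'] y Iy x'y Ix'.
  have xd : `|x - x'| < d by apply: lt_le_trans xx' _; lra.
  have yd : `|x - y| < d.
    apply: le_lt_trans (ler_distD x' _ _) _.
    move: xx' x'y; rewrite /ball/=; lra.
  have H1 := fd _ (abJ _ Ix') xd; have H2 := fd _ (abJ _ Iy) yd.
  apply: le_lt_trans (ler_distD (f x) _ _) _; rewrite (distrC (f x')); lra.
have H' := cov R (at_right (0:R)) (fun d x => forall y, `[a, b]%classic y -> `|x - y| < d ->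
  `[a, b]%classic x -> `|f x - f y| < e) _ H.
have [d [d0 Hd]] := @filter_ex _ (at_right (0:R)) _ _ (filterI (nbhs_right_gt 0) (H' _)).
by exists d => // x y Ix Iy xy; exact: Hd.
Qed.

(** The norm of [X * X] is the maximum, so both components are Cauchy in [X], the space whose
    completeness is given. *)
Lemma prod_cauchy_cvg {X : completeNormedModType R} (u : nat -> X * X) :
    (forall e, 0 < e -> exists N, forall n m, (N <= n)%N -> (N <= m)%N ->
       `|u n - u m| <= e) ->
  exists l : X * X, u n @[n --> \oo] --> l.
Proof.
move=> cu.
have cvg_comp (v : nat -> X) :
   (forall e, 0 < e -> exists N, forall n m, (N <= n)%N -> (N <= m)%N ->
      `|v n - v m| <= e) -> cvgn v.
  move=> cv; apply: cauchy_cvg; apply/cauchy_ballP => e e0.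
  have e2 : 0 < e / 2 by lra.
  have [N HN] := cv _ e2.
  exists (v @` [set n | (N <= n)%N], v @` [set n | (N <= n)%N]).
    by split; exists N => // n /= Nn; exists n.
  move=> [_ _] [/= [n Nn <-] [m Nm <-]].
  by rewrite -ball_normE/=; apply: le_lt_trans (HN _ _ Nn Nm) _; lra.
have c1 : cvgn (fst \o u).
  apply: cvg_comp => e /cu[N HN]; exists N => n m /HN/[apply].
  by rewrite prod_normE ge_max => /andP[].
have c2 : cvgn (snd \o u).
  apply: cvg_comp => e /cu[N HN]; exists N => n m /HN/[apply].
  by rewrite prod_normE ge_max => /andP[].
exists (limn (fst \o u), limn (snd \o u)).
rewrite (_ : u = fun n => ((fst \o u) n, (snd \o u) n)); last first.
  by apply/funext => n /=; case: (u n).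
exact: cvg_pair.
Qed.

(** Discrete stand-in for [Mean]: the average over left endpoints of a grid of [[0, h]], with 0
    included and [h] excluded. *)
Definition riemann_mean {V : normedModType R} (h : R) (n : nat) (f : R -> V) : V :=
  n.+1%:R^-1 *: \sum_(0 <= k < n.+1) f (k%:R * (h / n.+1%:R)).

Lemma cvg_riemann_mean {X : completeNormedModType R} (f : R -> X * X) h : 0 < h ->
    uniform_on `[0, h]%classic f ->
  riemann_mean h n f @[n --> \oo] --> h^-1 *: bochner_integral 0 h f.
Proof.
move=> h0 uf.
have -> : (fun n => riemann_mean h n f) =
    fun n => h^-1 *: simple_integral 0 h (step_approx 0 h f n).
  apply/funext => n; rewrite simple_integral_step_approx ?ltW// scalerA subr0.
  rewrite mulKf ?gt_eqF// /riemann_mean; congr (_ *: _).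
  by apply: eq_bigr => k _; rewrite /step_point add0r subr0.
apply: cvgZr; apply: cvg_simple_integral_step => //; first exact: ltW.
have [l Hl] := prod_cauchy_cvg (cauchy_step (ltW h0) uf).
exists l; exists (step_approx 0 h f) => //.
exact: bochner_approx_step (ltW h0) uf.
Qed.

End Cont.

(** * Rotations and a covering form of Baire's theorem *)

Section Rotations.
Set Implicit Arguments.
Unset Strict Implicit.
Context {R : realType}.

Lemma cos_lip (a b : R) : `|cos a - cos b| <= `|a - b|.
Proof.
wlog ab : a b / a <= b => [H|].
  have [/H//|/ltW/H] := leP a b; by rewrite distrC (distrC b).
have [c _ E] := @MVT_segment R cos (fun x => - sin x) a b ab
  (fun x _ => is_derive_cos x) (continuous_subspaceT (@continuous_cos R)).
rewrite distrC E normrM normrN (distrC a) ler_piMl//.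
exact: sin_max.
Qed.

Lemma sin_lip (a b : R) : `|sin a - sin b| <= `|a - b|.
Proof.
wlog ab : a b / a <= b => [H|].
  have [/H//|/ltW/H] := leP a b; by rewrite distrC (distrC b).
have [c _ E] := @MVT_segment R sin cos a b ab
  (fun x _ => is_derive_sin x) (continuous_subspaceT (@continuous_sin R)).
rewrite distrC E normrM (distrC a) ler_piMl//.
exact: cos_max.
Qed.

(** Take for [t'] the root of [t ^+ 2 + pi] on the same side as [t]. Then
    [|t'| - |t| = pi / (|t'| + |t|)], which is below [d] once [|t| >= pi / d]. The last clause keeps
    [t'] in the half-line. *)
Lemma exists_sqr_add_pi (d : R) : 0 < d -> exists2 T, 0 < T & forall t, T <= `|t| ->
  exists t', [/\ t' ^+ 2 = t ^+ 2 + pi, `|t - t'| < d & 0 <= t -> 0 <= t'].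
Proof.
move=> d0; have pi0 := pi_gt0 R.
exists (pi / d) => [|t]; first exact: divr_gt0.
rewrite ler_pdivrMr// => Ht.
pose q := Num.sqrt (t ^+ 2 + pi).
have q2 : q ^+ 2 = `|t| ^+ 2 + pi.
  by rewrite sqr_sqrtr ?real_normK ?num_real// addr_ge0 ?sqr_ge0// ltW.
have q0 : 0 <= q by exact: sqrtr_ge0.
have t0 := normr_ge0 t.
have tq : `|t| < q by nra.
have qd : q - `|t| < d by nra.
have [t1|t1] := leP 0 t.
  exists q; split=> //; first by rewrite q2 real_normK ?num_real.
  by move: tq qd; rewrite ger0_norm// => tq qd; rewrite distrC ger0_norm; lra.
exists (- q); split=> //; first by rewrite sqrrN q2 real_normK ?num_real.
by move: tq qd; rewrite ltr0_norm// => tq qd; rewrite ger0_norm; lra.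
Qed.

Context {X : normedModType R}.
Implicit Types (a b : R) (y : X * X).

Definition rot a y : X * X := cscale (cos a +i* sin a)%C y.

Lemma rotD a b y : rot a (rot b y) = rot (a + b) y.
Proof.
rewrite /rot cscaleA; congr cscale.
by rewrite cosD sinD; simpc; rewrite [X in (_ +i* X)%C]addrC.
Qed.

Lemma rot0 y : rot 0 y = y.
Proof. by rewrite /rot cos0 sin0 cscale1. Qed.

Lemma rotK a : cancel (rot a) (rot (- a)).
Proof. by move=> y; rewrite rotD addNr rot0. Qed.

Lemma rotNK a : cancel (rot (- a)) (rot a).
Proof. by move=> y; rewrite rotD subrr rot0. Qed.

Lemma rotDpi a y : rot (a + pi) y = - rot a y.
Proof.
rewrite /rot cosDpi sinDpi /cscale/=.
by rewrite !scaleNr; congr pair; rewrite opprD ?opprK.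
Qed.

Lemma rotDr a y z : rot a (y + z) = rot a y + rot a z.
Proof. exact: cscaleDr. Qed.

Lemma rotN a y : rot a (- y) = - rot a y.
Proof.
apply/eqP; rewrite -subr_eq0 opprK -rotDr addNr.
by rewrite /rot /cscale/= !scaler0 subr0 addr0.
Qed.

Lemma rotB a y z : rot a (y - z) = rot a y - rot a z.
Proof. by rewrite rotDr rotN. Qed.

Lemma rotZ a c y : rot a (c *: y) = c *: rot a y.
Proof.
by apply: injective_projections => /=; rewrite ?scalerBr ?scalerDr !scalerA !(mulrC c).
Qed.

Lemma rot_sum a I (r : seq I) (F : I -> X * X) :
  rot a (\sum_(i <- r) F i) = \sum_(i <- r) rot a (F i).
Proof.
elim: r => [|i r IH]; first by rewrite !big_nil -(subrr (0 : X * X)) rotB !subrr.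
by rewrite !big_cons rotDr IH.
Qed.

Lemma norm_cscale (z : R[i]) y :
  `|cscale z y| <= (`|complex.Re z| + `|complex.Im z|) * `|y|.
Proof.
rewrite prod_normE ge_max /cscale/= prod_normE.
have H (c d : R) : `|c *: y.1| + `|d *: y.2| <= (`|c| + `|d|) * Num.max `|y.1| `|y.2|.
  by rewrite !normrZ mulrDl lerD// ler_wpM2l// le_max lexx ?orbT.
apply/andP; split; first exact: le_trans (ler_normB _ _) (H _ _).
by rewrite (addrC `|_|); apply: le_trans (ler_normD _ _) (H _ _).
Qed.

(** Multiplication by e^{ia} is not an isometry for the maximum norm on [X * X]; the factor 2 bounds
    [|cos a| + |sin a|]. *)
Lemma norm_rot a y : `|rot a y| <= 2 * `|y|.
Proof.
apply: le_trans (norm_cscale _ _) _; rewrite ler_wpM2r//=.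
have := cos_max a; have := sin_max a; lra.
Qed.

Lemma norm_rot_ge a y : `|y| <= 2 * `|rot a y|.
Proof. by rewrite -{1}(rotK a y) norm_rot. Qed.

Lemma rot_lip a b y : `|rot a y - rot b y| <= 2 * `|a - b| * `|y|.
Proof.
have -> : rot a y - rot b y = cscale ((cos a - cos b) +i* (sin a - sin b))%C y.
  rewrite /rot /cscale; apply: injective_projections => /=; rewrite !scalerBl ?opprD ?opprK.
    by rewrite addrACA.
  by rewrite addrACA.
apply: le_trans (norm_cscale _ _) _; rewrite ler_wpM2r//=.
have := cos_lip a b; have := sin_lip a b; lra.
Qed.

End Rotations.

Section Baire_cover.
Set Implicit Arguments.
Unset Strict Implicit.
Context {R : realType}.

(** If no closure had interior points, the complements of the closures would be open and dense, and
    Baire would give a point of []0, 1[] outside every [A k]. The [A k] are arbitrary, so density in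
    an interval is obtained rather than inclusion. *)
Lemma baire_cover (A : nat -> set R) : (forall s, 0 < s -> exists k, A k s) ->
  exists k a b, [/\ 0 < a, a < b & forall s, a < s -> s < b -> forall e, 0 < e ->
     exists s', A k s' /\ `|s - s'| < e].
Proof.
move=> covA.
pose B k := A k `&` [set s | 0 < s].
have [k nd] : exists k, ~ dense (~` closure (B k)).
  apply: contrapT => /forallNP H.
  have /Baire D : forall k, open (~` closure (B k)) /\ dense (~` closure (B k)).
    move=> k; split; first by rewrite openC; exact: closed_closure.
    by have := H k; move/contrapT.
  have D01 := D `]0, 1[%classic.
  case: D01 => [||s].
  - by exists (1 / 2); rewrite /= in_itv/=; lra.
  - exact: interval_open.
  move=> [/=]; rewrite in_itv/= => /andP[s0 _] Hs.
  have [k Ak] := covA _ s0.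
  by apply: (Hs k I); apply: subset_closure.
have [U [x Ux] [oU Usub]] : exists2 U : set R, U !=set0 & open U /\ U `<=` closure (B k).
  apply: contrapT => H; apply: nd => U U0 oU.
  apply: contrapT => H'; apply: H; exists U => //; split=> // x Ux.
  by apply: contrapT => nx; apply: H'; exists x.
have nbhsU y : U y -> exists2 r, 0 < r & forall z, `|y - z| < r -> U z.
  by move=> Uy; have /nbhs_ballP[r r0 H] := open_nbhs_nbhs (conj oU Uy); exists r.
have [s [[_ /= s0] Us]] := Usub _ Ux U (open_nbhs_nbhs (conj oU Ux)).
have [r r0 Hr] := nbhsU _ Us.
(* The interval stays in the ball of radius [r] about [s], and [s / 2] keeps its left end
   positive. *)
exists k, (Num.max (s / 2) (s - r)), (s + r); split.
- by rewrite lt_max; apply/orP; left; lra.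
- by rewrite gt_max; apply/andP; split; lra.
move=> t; rewrite gt_max => /andP[_ t1] t2 e e0.
have Ut : U t by apply: Hr; rewrite ltr_distlC; apply/andP; split; lra.
have [s' [[As' _] ts']] := Usub _ Ut _ (nbhsx_ballx t e e0).
by exists s'.
Qed.

End Baire_cover.

(** * Uniformly continuous functions on the half-line and the line *)

Section UniformContinuity.
Set Implicit Arguments.
Unset Strict Implicit.
Context {R : realType} (J : set R).
Hypothesis hJ : J = [set t : R | 0 <= t] \/ J = [set: R].

Lemma domain_ge0 t : 0 <= t -> J t.
Proof. by case: hJ => ->. Qed.

Lemma domainD t s : J t -> 0 <= s -> J (t + s).
Proof. by case: hJ => -> //= ? ?; exact: addr_ge0. Qed.

Lemma domain_conv x y c : J x -> J y -> 0 <= c <= 1 -> J (x + c * (y - x)).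
Proof.
case: hJ => -> //= x0 y0 /andP[c0 c1].
have -> : x + c * (y - x) = (1 - c) * x + c * y by ring.
by rewrite addr_ge0// mulr_ge0// subr_ge0.
Qed.

Section Normed.
Context {V : normedModType R}.
Implicit Types (W : R -> V).

Lemma UC_cont W : UC J W -> cont_on J W.
Proof.
by move=> uW x Jx e /uW[d d0 H]; exists d => // y Jy; exact: H.
Qed.

(** [J] is convex, so [y] is reached from [x] in equal steps of length at most [d / 2], each
    changing [W] by at most 1. *)
Lemma UC_coarse W : UC J W -> forall L, exists C, forall x y, J x -> J y ->
  `|x - y| <= L -> `|W x - W y| <= C.
Proof.
move=> uW L; have [d d0 H] := uW _ (@ltr01 R).
have d2 : 0 < d / 2 by lra.
have step n : forall x y, J x -> J y -> `|x - y| <= n%:R * (d / 2) -> `|W x - W y| <= n%:R.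
  elim: n => [|n IH] x y Jx Jy.
    by rewrite mul0r normr_le0 subr_eq0 => /eqP ->; rewrite subrr normr0.
  move=> xy; set z := x + n.+1%:R^-1 * (y - x).
  have n1 : (0 : R) < n.+1%:R^-1 by rewrite invr_gt0.
  have Jz : J z.
    apply: domain_conv => //; rewrite ltW//= invf_le1// ler1n//.
  have nn : n.+1%:R * n.+1%:R^-1 = 1 :> R by rewrite divff.
  have E1 : `|x - z| <= d / 2.
    have -> : x - z = n.+1%:R^-1 * (x - y) by rewrite /z; ring.
    by rewrite normrM gtr0_norm// mulrC ler_pdivrMr// mulrC.
  have E2 : `|z - y| <= n%:R * (d / 2).
    have -> : z - y = n%:R * (n.+1%:R^-1 * (x - y)).
      rewrite /z; have -> : n%:R = n.+1%:R - 1 :> R by rewrite -natr1 addrK.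
      rewrite mulrBl mulrA nn; ring.
    rewrite normrM ger0_norm// ler_wpM2l//.
    by rewrite normrM gtr0_norm// mulrC ler_pdivrMr// mulrC.
  apply: le_trans (ler_distD (W z) _ _) _; rewrite -natr1 addrC lerD//.
    exact: IH.
  by apply/ltW/H => //; apply: le_lt_trans E1 _; lra.
exists (Num.truncn (L / (d / 2))).+1%:R => x y Jx Jy xy; apply: step => //.
apply: (le_trans xy); rewrite -ler_pdivrMr//.
by rewrite ltW// truncnS_gt.
Qed.

Lemma UC_eq W W' : (forall t, J t -> W t = W' t) -> UC J W -> UC J W'.
Proof.
move=> E uW e /uW[d d0 H]; exists d => // x y Jx Jy xy.
by rewrite -!E//; exact: H.
Qed.

Lemma UC_sub W W' : UC J W -> UC J W' -> UC J (fun t => W t - W' t).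
Proof.
move=> uW uW' e e0; have e2 : 0 < e / 2 by lra.
have [d d0 H] := uW _ e2; have [d' d'0 H'] := uW' _ e2.
exists (Num.min d d') => [|x y Jx Jy]; first by rewrite lt_min d0.
rewrite lt_min => /andP[xy xy'].
rewrite opprD addrACA -opprD; apply: le_lt_trans (ler_normB _ _) _.
have := H _ _ Jx Jy xy; have := H' _ _ Jx Jy xy'; lra.
Qed.

Lemma UC_shift W r : 0 <= r -> UC J W -> UC J (fun t => W (t + r)).
Proof.
move=> r0 uW e /uW[d d0 H]; exists d => // x y Jx Jy xy.
apply: H; [exact: domainD|exact: domainD|].
by rewrite opprD addrACA subrr addr0.
Qed.

Lemma BUC_eq W W' : (forall t, J t -> W t = W' t) -> BUC J W -> BUC J W'.
Proof.
move=> E [uW [M HM]]; split; first exact: UC_eq uW.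
by exists M => t Jt; rewrite -E// HM.
Qed.

Lemma BUC_sub W W' : BUC J W -> BUC J W' -> BUC J (fun t => W t - W' t).
Proof.
move=> [uW [M HM]] [uW' [M' HM']]; split; first exact: UC_sub.
by exists (M + M') => t Jt; rewrite (le_trans (ler_normB _ _))// lerD ?HM ?HM'.
Qed.

Lemma BUC_shift W r : 0 <= r -> BUC J W -> BUC J (fun t => W (t + r)).
Proof.
move=> r0 [uW [M HM]]; split; first exact: UC_shift.
by exists M => t Jt; apply: HM; exact: domainD.
Qed.

Lemma cont_on_eq W W' : (forall t, J t -> W t = W' t) -> cont_on J W -> cont_on J W'.
Proof.
move=> E uW x Jx e /(uW _ Jx)[d d0 H]; exists d => // y Jy xy.
by rewrite -!E//; exact: H.
Qed.

Lemma cont_on_sub W W' : cont_on J W -> cont_on J W' -> cont_on J (fun t => W t - W' t).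
Proof.
move=> uW uW' x Jx e e0; have e2 : 0 < e / 2 by lra.
have [d d0 H] := uW _ Jx _ e2; have [d' d'0 H'] := uW' _ Jx _ e2.
exists (Num.min d d') => [|y Jy]; first by rewrite lt_min d0.
rewrite lt_min => /andP[xy xy'].
rewrite opprD addrACA -opprD; apply: le_lt_trans (ler_normB _ _) _.
have := H _ Jy xy; have := H' _ Jy xy'; lra.
Qed.

Lemma cont_on_shift W r : 0 <= r -> cont_on J W -> cont_on J (fun t => W (t + r)).
Proof.
move=> r0 uW x Jx e /(uW _ (domainD Jx r0))[d d0 H]; exists d => // y Jy xy.
apply: H; first exact: domainD.
by rewrite opprD addrACA subrr addr0.
Qed.

End Normed.

(** * Removing the factor e^{it^2}, and the cocycle identity *)

Section Twist.
Context {X : normedModType R}.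
Implicit Types (W f : R -> X * X).

Lemma dist_rot a b (y z : X * X) :
  `|rot a y - rot b z| <= 2 * `|a - b| * `|y| + 2 * `|y - z|.
Proof.
apply: le_trans (ler_distD (rot b y) _ _) _; apply: lerD; first exact: rot_lip.
by rewrite -rotB norm_rot.
Qed.

Lemma cont_on_rot (theta : R -> R) W :
    (forall x e, 0 < e -> exists2 d, 0 < d & forall y, `|x - y| < d ->
       `|theta x - theta y| < e) ->
  cont_on J W -> cont_on J (fun t => rot (theta t) (W t)).
Proof.
move=> ct cW x Jx e e0.
have e4 : 0 < e / 4 by lra.
have W0 := normr_ge0 (W x).
have eW : 0 < e / 4 / (`|W x| + 1) by rewrite divr_gt0//; lra.
have [d d0 H] := cW _ Jx _ e4; have [d' d'0 H'] := ct x _ eW.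
exists (Num.min d d') => [|y Jy]; first by rewrite lt_min d0.
rewrite lt_min => /andP[xy xy'].
apply: le_lt_trans (dist_rot _ _ _ _) _.
have H1 := H _ Jy xy.
have := H' _ xy'; rewrite ltr_pdivlMr; last lra.
have := normr_ge0 (theta x - theta y); nra.
Qed.

Lemma continuous_sqr_eps (x e : R) : 0 < e ->
  exists2 d, 0 < d & forall y, `|x - y| < d -> `|x ^+ 2 - y ^+ 2| < e.
Proof.
move=> e0; have x0 := normr_ge0 x.
have d0 : 0 < e / (2 * `|x| + 1) by rewrite divr_gt0//; lra.
exists (Num.min 1 (e / (2 * `|x| + 1))) => [|y]; first by rewrite lt_min ltr01.
rewrite lt_min => /andP[xy]; rewrite ltr_pdivlMr; last lra.
rewrite subr_sqr normrM => xy'.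
have H : `|x + y| <= 2 * `|x| + 1.
  have -> : x + y = 2 * x - (x - y) by ring.
  apply: le_trans (ler_normB _ _) _; rewrite normrM ger0_norm//; lra.
by apply: le_lt_trans xy'; rewrite ler_wpM2l.
Qed.

(* Multiplication by e^{-it^2}, so that f lies in chirp * U iff twist f lies in U. *)
Definition twist f : R -> X * X := fun t => rot (- t ^+ 2) (f t).

Lemma twistK f t : rot (t ^+ 2) (twist f t) = f t.
Proof. by rewrite /twist rotNK. Qed.

Lemma mul_space_UCP f : mul_space J chirp (UC J) f <-> UC J (twist f).
Proof.
split=> [[w uw E]|uf].
  apply: UC_eq uw => t Jt; rewrite /twist E//.
  by rewrite -[cscale (chirp t) _]/(rot (t ^+ 2) _) rotK.
by exists (twist f) => // t Jt; rewrite -[RHS]/(rot (t ^+ 2) _) twistK.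
Qed.

Lemma mul_space_BUCP f : mul_space J chirp (BUC J) f <-> BUC J (twist f).
Proof.
split=> [[w uw E]|uf].
  apply: BUC_eq uw => t Jt; rewrite /twist E//.
  by rewrite -[cscale (chirp t) _]/(rot (t ^+ 2) _) rotK.
by exists (twist f) => // t Jt; rewrite -[RHS]/(rot (t ^+ 2) _) twistK.
Qed.

Lemma twist_cont f : UC J (twist f) -> cont_on J f.
Proof.
move=> /UC_cont cf; have := cont_on_rot (@continuous_sqr_eps) cf.
by apply: cont_on_eq => t _; rewrite twistK.
Qed.

(** The affine phase is Lipschitz with constant [|a|], and its variation gets multiplied by the size
    of [W]; this is where boundedness enters. *)
Lemma BUC_rot W (a b : R) : BUC J W -> BUC J (fun t => rot (a * t + b) (W t)).
Proof.
move=> [uW [M HM]]; split; last first.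
  exists (2 * M) => t Jt; apply: le_trans (norm_rot _ _) _.
  by rewrite ler_pM2l// HM.
move=> e e0; have e4 : 0 < e / 4 by lra.
have M0 : 0 <= M by apply: le_trans (HM 0 (domain_ge0 (lexx 0))).
have a0 := normr_ge0 a.
have aM : 0 <= `|a| * M by apply: mulr_ge0.
have eW : 0 < e / 4 / (`|a| * M + 1) by rewrite divr_gt0//; lra.
have [d d0 H] := uW _ e4.
exists (Num.min d (e / 4 / (`|a| * M + 1))) => [|x y Jx Jy]; first by rewrite lt_min d0.
rewrite lt_min => /andP[xy]; rewrite ltr_pdivlMr => [xy'|]; last lra.
apply: le_lt_trans (dist_rot _ _ _ _) _.
have H1 := H _ _ Jx Jy xy.
have -> : a * x + b - (a * y + b) = a * (x - y) by ring.
rewrite normrM.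
have H2 : `|a| * `|x - y| * `|W x| <= `|a| * `|x - y| * M.
  by rewrite ler_wpM2l ?mulr_ge0 ?HM.
have := normr_ge0 (x - y); nra.
Qed.

Lemma Delta_shift f s r t : Delta s f (t + r) = Delta (s + r) f t - Delta r f t.
Proof.
rewrite /Delta opprB addrC addrA subrK addrC.
by congr (f _ - _); ring.
Qed.

(** The cocycle identity: the quadratic phases at [t] and [t + r] differ by an affine one, which is
    harmless on bounded uniformly continuous functions. *)
Lemma twist_Delta_shift f s r t :
  rot (2 * r * t + r ^+ 2) (twist (Delta s f) (t + r)) =
  twist (Delta (s + r) f) t - twist (Delta r f) t.
Proof.
rewrite /twist rotD -rotB -Delta_shift; congr (rot _ _); ring.
Qed.

End Twist.
End UniformContinuity.

(** * Differences of f *)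

Lemma subrACA (V : zmodType) (a b c d : V) : (a - b) - (c - d) = (a - c) - (b - d).
Proof. by rewrite opprD addrACA -opprD. Qed.

Lemma subr_addACA (V : zmodType) (a b c d : V) : (a + b) - (c + d) = (a - c) + (b - d).
Proof. by rewrite opprD addrACA. Qed.

Section TwistedDifferences.
Set Implicit Arguments.
Unset Strict Implicit.
Context {R : realType} (J : set R).
Hypothesis hJ : J = [set t : R | 0 <= t] \/ J = [set: R].
Context {X : normedModType R} (f : R -> X * X).
Hypothesis uf : forall s, 0 < s -> UC J (twist (Delta s f)).
Implicit Types (s t e : R).

(* u_{s+1}(t) - u_1(t) = e^{i(2t+1)} u_s(t+1) is uniformly continuous; its
   phase flips between t and t + pi/2, whereas u_s varies boundedly. *)
Lemma twist_Delta_bounded s : 0 < s -> exists K, forall t, J t ->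
  `|twist (Delta s f) t| <= K.
Proof.
move=> s0; set u := twist (Delta s f).
have uW : UC J (fun t => rot (2 * 1 * t + 1 ^+ 2) (u (t + 1))).
  apply: (@UC_eq _ J _ (fun t => twist (Delta (s + 1) f) t - twist (Delta 1 f) t)).
    by move=> t _; rewrite twist_Delta_shift.
  by apply: UC_sub; apply: uf => //; lra.
have pi0 := pi_gt0 R.
have [C HC] := UC_coarse hJ uW (pi / 2).
(* The radius covers both displacements used below, [pi / 2] and 1. *)
have [C' HC'] := UC_coarse hJ (uf s0) (pi / 2 + 1).
exists (2 * C + 2 * C') => t Jt.
have J1 : J (t + 1) by apply: domainD => //; lra.
have Jp : J (t + pi / 2) by apply: domainD => //; lra.
have Jp1 : J (t + pi / 2 + 1) by apply: domainD => //; lra.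
have H1 : `|u (t + pi / 2 + 1) + u (t + 1)| <= 2 * C.
  have := HC _ _ Jp Jt _.
  have -> : 2 * 1 * (t + pi / 2) + 1 ^+ 2 = 2 * 1 * t + 1 ^+ 2 + pi :> R by field.
  rewrite rotDpi -opprD -rotDr normrN => H.
  apply: le_trans (norm_rot_ge (2 * 1 * t + 1 ^+ 2) _) _.
  rewrite ler_pM2l//; apply: H.
  have -> : t + pi / 2 - t = pi / 2 by ring.
  by rewrite ger0_norm; lra.
have H2 : `|u (t + pi / 2 + 1) - u (t + 1)| <= C'.
  apply: HC' => //; have -> : t + pi / 2 + 1 - (t + 1) = pi / 2 by ring.
  by rewrite ger0_norm; lra.
have H3 : `|u t - u (t + 1)| <= C'.
  apply: HC' => //; have -> : t - (t + 1) = - 1 by ring.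
  by rewrite normrN normr1; lra.
have H4 : 2 * `|u (t + 1)| <= 2 * C + C'.
  rewrite -[2]ger0_norm// -normrZ scaler_nat mulr2n.
  have -> : u (t + 1) + u (t + 1) =
     (u (t + pi / 2 + 1) + u (t + 1)) - (u (t + pi / 2 + 1) - u (t + 1)).
    by rewrite opprB [RHS]addrC addrA subrK.
  by apply: le_trans (ler_normB _ _) _; rewrite ger0_norm// lerD.
have := ler_normD (u t - u (t + 1)) (u (t + 1)); rewrite subrK.
have := normr_ge0 (u (t + 1)); lra.
Qed.

Lemma Delta_cont s : 0 < s -> cont_on J (Delta s f).
Proof. by move=> s0; apply: twist_cont; exact: uf. Qed.

(** Equicontinuity at the single level [e], with a common bound. Fixing [e] lets countably many
    pairs [(d, K)] account for all [s], as Baire requires. *)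
Definition equi_twist (A : set R) d e K := forall s, A s ->
  (forall x y, J x -> J y -> `|x - y| < d ->
     `|twist (Delta s f) x - twist (Delta s f) y| <= e) /\
  forall x, J x -> `|twist (Delta s f) x| <= K.

(* p(x) = f(x+s') - f(x+s) is p(0) up to a small error, while twist p hardly
   varies on short intervals: at two nearby points with squares differing by pi
   this gives p(0) ~ - p(0). *)
Lemma eps_continuity s d e K : 0 < s -> 0 < d -> 0 < e ->
  exists2 r, 0 < r & forall s', 0 < s' -> equi_twist [set s'] d e K ->
    `|s - s'| < r -> `|f s' - f s| <= 3 * e.
Proof.
move=> s0 d0 e0; have [ds ds0 Hs] := uf s0 e0.
have pi0 := pi_gt0 R.
(* Points closer than [m] obey both the modulus for [s'] and the one for [s]. *)
pose m := Num.min d ds.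
have m0 : 0 < m by rewrite lt_min d0.
have [t t0 Ht] := exists_sqr_add_pi m0.
have [t' [t'2 Htt' /(_ (ltW t0)) t'0]] := Ht t (ler_norm t).
have tt' : t < t' by nra.
have [Jt Jt'] : J t /\ J t' by split; apply: (domain_ge0 hJ) => //; exact: ltW.
have Js : J s by apply: (domain_ge0 hJ); exact: ltW.
have t'0' : 0 < t' by apply: lt_trans tt'.
(* The points [t] and [t'] do not depend on [s'], so one radius serves all [s']. *)
have [r r0 Hr] := Delta_cont t0 Js e0.
have [r' r'0 Hr'] := Delta_cont t'0' Js e0.
exists (Num.min r r') => [|s' s'0 /(_ s' erefl)[Hs' _]]; first by rewrite lt_min r0.
rewrite lt_min => /andP[sr sr'].
have Js' : J s' by apply: (domain_ge0 hJ); exact: ltW.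
move: Htt'; rewrite lt_min => /andP[td tds].
pose p x := f (x + s') - f (x + s).
(* [p x] differs from [f s' - f s] by an increment of [Delta x f], which is continuous for [x > 0]
   although [f] is not yet known to be. *)
have pE x : p x = (f s' - f s) - (Delta x f s - Delta x f s').
  rewrite /p /Delta (addrC x) (addrC x) opprD opprK addrA opprB subrKA.
  by rewrite [RHS]addrC subrKA.
have twp x : twist p x = twist (Delta s' f) x - twist (Delta s f) x.
  by rewrite /twist -rotB /Delta opprB subrKA.
have H1 : `|twist p t - twist p t'| <= 2 * e.
  rewrite !twp opprD addrACA -opprD; apply: le_trans (ler_normB _ _) _.
  have := Hs' _ _ Jt Jt' td; have := Hs _ _ Jt Jt' tds; lra.
have H2 : `|p t + p t'| <= 4 * e.
  apply: le_trans (norm_rot_ge (- t ^+ 2) _) _.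
  have -> : rot (- t ^+ 2) (p t + p t') = twist p t - twist p t'.
    rewrite rotDr /twist t'2; congr (_ + _).
    by rewrite -rotDpi; congr rot; ring.
  lra.
have H3 := Hr _ Js' sr; have H4 := Hr' _ Js' sr'.
have : `|2%:R *: (f s' - f s)| <= 6 * e.
  rewrite scaler_nat mulr2n.
  have -> : f s' - f s + (f s' - f s) = p t + p t' +
      ((Delta t f s - Delta t f s') + (Delta t' f s - Delta t' f s')).
    by rewrite [RHS]addrACA; congr (_ + _); rewrite pE subrK.
  apply: le_trans (ler_normD _ _) _.
  have := ler_normD (Delta t f s - Delta t f s') (Delta t' f s - Delta t' f s').
  lra.
rewrite normrZ ger0_norm//; lra.
Qed.

(** The integer [k] encodes both the modulus [1 / (k + 1)] and the bound [k + 1]; each [s > 0]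
    belongs to some [A k] by uniform continuity and boundedness of its twisted difference. *)
Lemma equi_twist_dense e : 0 < e -> exists a b d K, [/\ 0 < a, a < b, 0 < d &
  forall s, a < s -> s < b -> forall r, 0 < r -> exists s',
    [/\ 0 < s', equi_twist [set s'] d e K & `|s - s'| < r]].
Proof.
move=> e0.
pose A k := [set s | 0 < s /\ equi_twist [set s] k.+1%:R^-1 e k.+1%:R].
have covA s : 0 < s -> exists k, A k s.
  move=> s0; have [d d0 Hd] := uf s0 e0; have [K HK] := twist_Delta_bounded s0.
  exists (Num.truncn (Num.max K d^-1)); split=> // _ ->.
  have H := truncnS_gt (Num.max K d^-1).
  split=> [x y Jx Jy xy|x Jx].
    apply/ltW/Hd => //; apply: lt_trans xy _.
    by rewrite invf_plt ?posrE//; apply: le_lt_trans H; rewrite le_max lexx orbT.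
  apply: le_trans (HK _ Jx) _; apply/ltW; apply: le_lt_trans H.
  by rewrite le_max lexx.
have [k [a [b [a0 ab H]]]] := baire_cover covA.
exists a, b, k.+1%:R^-1, k.+1%:R; split; rewrite ?invr_gt0//.
by move=> s as_ sb r r0; have [s' [[s'0 As'] ss']] := H _ as_ sb _ r0; exists s'.
Qed.

(** A point [y] near the midpoint [m] is compared with [m] through a point [s'] of the dense set,
    [eps_continuity] being applied at [y] and at [m]. The estimate near [m] is then carried to any
    [x] by the continuous difference of step [|x - m|]. *)
Lemma cont_on_of_twisted_differences : cont_on J f.
Proof.
(* The comparison through [s'] costs 3 + 3 units of [e / 14], the transport from [m] to [x] another
   [e / 2]: 13 units in all. *)
move=> x Jx e e0; have e14 : 0 < e / 14 by lra.
have [a [b [d [K [a0 ab d0 H]]]]] := equi_twist_dense e14.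
pose m := (a + b) / 2.
have [am mb] : a < m /\ m < b by rewrite /m; lra.
have m0 : 0 < m by lra.
have [r r0 Hm] : exists2 r, 0 < r & forall y, `|m - y| < r ->
    0 < y /\ `|f m - f y| <= 6 * (e / 14).
  have [r r0 Hr] := eps_continuity K m0 d0 e14.
  have q0 : 0 < Num.min (r / 2) (Num.min (m - a) (b - m)).
    by rewrite !lt_min; apply/and3P; split; lra.
  exists (Num.min (r / 2) (Num.min (m - a) (b - m))) => // y.
  rewrite !lt_min => /and3P[yr ya yb].
  have ay : a < y by have := ler_norm (m - y); lra.
  have yb' : y < b by have := ler_norm (y - m); rewrite distrC; lra.
  split; first lra.
  have [ry ry0 Hry] := eps_continuity K (lt_trans a0 ay) d0 e14.
  have [s' [s'0 As' ys']] : exists s', [/\ 0 < s', equi_twist [set s'] d (e / 14) K &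
      `|y - s'| < Num.min ry (r / 2)].
    by apply: H => //; rewrite lt_min ry0; lra.
  move: ys'; rewrite lt_min => /andP[ys' ys'2].
  have H1 := Hry _ s'0 As' ys'.
  have H2 : `|f s' - f m| <= 3 * (e / 14).
    apply: Hr => //; apply: le_lt_trans (ler_distD y _ _) _; lra.
  apply: le_trans (ler_distD (f s') _ _) _.
  rewrite distrC; lra.
have near_m y : J y -> `|m - y| < r -> `|f m - f y| <= 6 * (e / 14).
  by move=> _ /Hm[].
have e2 : 0 < e / 2 by lra.
have Jm : J m by apply: (domain_ge0 hJ); exact: ltW.
have [xm|mx|xm] := ltgtP x m.
- have xm0 : 0 < m - x by lra.
  have [r' r'0 Hr'] := Delta_cont xm0 Jx e2.
  exists (Num.min r r') => [|y Jy]; first by rewrite lt_min r0.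
  rewrite lt_min => /andP[yr yr'].
  have E z : f z = f (z + (m - x)) - Delta (m - x) f z by rewrite /Delta subKr.
  rewrite (E x) (E y) subrACA.
  have -> : x + (m - x) = m by ring.
  apply: le_lt_trans (ler_normB _ _) _.
  have := Hr' _ Jy yr'; have [|_] := Hm (y + (m - x)); last lra.
  by have -> : m - (y + (m - x)) = x - y by ring.
- have xm0 : 0 < x - m by lra.
  have [r' r'0 Hr'] := Delta_cont xm0 Jm e2.
  exists (Num.min r r') => [|y Jy]; first by rewrite lt_min r0.
  rewrite lt_min => /andP[yr yr'].
  have E z : f (z + (x - m)) = f z + Delta (x - m) f z by rewrite /Delta [RHS]addrC subrK.
  have -> : x = m + (x - m) by ring.
  have -> : y = (y - (x - m)) + (x - m) by ring.
  rewrite !E subr_addACA.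
  apply: le_lt_trans (ler_normD _ _) _.
  have my : m - (y - (x - m)) = x - y by ring.
  have [|y0 H1] := Hm (y - (x - m)); first by rewrite my.
  have := Hr' (y - (x - m)) _ _; rewrite my => /(_ _ yr') H2.
  have := H2 (domain_ge0 hJ (ltW y0)); lra.
- by exists r => // y Jy; rewrite xm => /Hm[_]; lra.
Qed.

Lemma equi_twist_le (A A' : set R) d d' e e' K K' : A' `<=` A -> d' <= d ->
  e <= e' -> K <= K' -> equi_twist A d e K -> equi_twist A' d' e' K'.
Proof.
move=> AA dd ee KK H s /AA/H[H1 H2]; split=> [x y Jx Jy xy|x Jx].
  by apply: le_trans ee; apply: H1 => //; apply: lt_le_trans dd.
by apply: le_trans KK; exact: H2.
Qed.

Lemma twist_Delta_dist s s' t :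
  `|twist (Delta s f) t - twist (Delta s' f) t| <= 2 * `|f (t + s) - f (t + s')|.
Proof. by rewrite /twist -rotB /Delta opprB subrKA norm_rot. Qed.

(** With [f] continuous, the twisted difference at a fixed point depends continuously on [s]. The
    estimates on the dense set thus extend to the interval, [s'] being chosen after the points [x]
    and [y]. *)
Lemma equi_twist_interval e : 0 < e -> exists a b d K, [/\ 0 < a, a < b, 0 < d &
  equi_twist [set s | a < s < b] d e K].
Proof.
move=> e0; have e2 : 0 < e / 2 by lra.
have [a [b [d [K [a0 ab d0 H]]]]] := equi_twist_dense e2.
have cf := cont_on_of_twisted_differences.
have approx s x : a < s < b -> J x -> exists2 r, 0 < r &
    forall s', 0 < s' -> `|s - s'| < r ->
    `|twist (Delta s f) x - twist (Delta s' f) x| <= e / 4.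
  move=> /andP[as_ sb] Jx; have e8 : 0 < e / 8 by lra.
  have s0 : 0 <= s by lra.
  have [r r0 Hr] := cf _ (domainD hJ Jx s0) _ e8; exists r => // s' s'0 ss'.
  apply: le_trans (twist_Delta_dist _ _ _) _.
  have := Hr (x + s') (domainD hJ Jx (ltW s'0)).
  have -> : x + s - (x + s') = s - s' by ring.
  move=> /(_ ss'); lra.
exists a, b, d, (K + e); split=> // s /= abs.
have [as_ sb] := andP abs.
split=> [x y Jx Jy xy|x Jx].
  have [rx rx0 Hx] := approx _ _ abs Jx; have [ry ry0 Hy] := approx _ _ abs Jy.
  have [|s' [s'0 /(_ s' erefl)[As' _]]] := H s as_ sb (Num.min rx ry).
    by rewrite lt_min rx0.
  rewrite lt_min => /andP[sx sy].
  apply: le_trans (ler_distD (twist (Delta s' f) x) _ _) _.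
  have := ler_distD (twist (Delta s' f) y) (twist (Delta s' f) x) (twist (Delta s f) y).
  have := Hx _ s'0 sx; have := Hy _ s'0 sy; rewrite (distrC (twist (Delta s f) y)).
  have := As' _ _ Jx Jy xy; lra.
have [rx rx0 Hx] := approx _ _ abs Jx.
have [s' [s'0 /(_ s' erefl)[_ As'] sx]] := H s as_ sb rx rx0.
rewrite -(subrK (twist (Delta s' f) x) (twist (Delta s f) x)).
apply: le_trans (ler_normD _ _) _.
have := Hx _ s'0 sx; have := As' _ Jx; lra.
Qed.

(** The cocycle identity with shift [m] brings parameters near 0 into []a, b[], at the price of
    evaluating at [x - m]. Where that leaves the half-line, the points lie in a compact segment on
    which [f] is uniformly continuous and its small differences are small. *)
Lemma equi_twist_start e : 0 < e -> exists r d K, [/\ 0 < r, 0 < d &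
  equi_twist [set s | 0 <= s <= r] d e K].
Proof.
move=> e0; have e8 : 0 < e / 8 by lra.
have [a [b [d [K [a0 ab d0 H]]]]] := equi_twist_interval e8.
pose m := (a + b) / 2.
have [am mb] : a < m /\ m < b by rewrite /m; lra.
have m0 : 0 < m by lra.
have Hm : [set s | a < s < b] m by rewrite /= am mb.
have K0 : 0 <= K.
  have [_ /(_ 0 (domain_ge0 hJ (lexx 0)))] := H m Hm; exact: le_trans.
have sub : `[0, m + 2]%classic `<=` J.
  by move=> x /=; rewrite in_itv/= => /andP[x0 _]; exact: domain_ge0.
have e4 : 0 < e / 4 by lra.
have [r r0 Hr] := cont_on_uniform sub cont_on_of_twisted_differences e4.
(* The three bounds keep [s] below the modulus of [f], [x + s] in [[0, m + 2]], and [s + m] below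
   [b]. *)
pose q := Num.min (r / 2) (Num.min 1 ((b - m) / 2)).
have q0 : 0 < q by rewrite /q !lt_min; apply/and3P; split; lra.
have [qr [q1 qb]] : q <= r / 2 /\ q <= 1 /\ q <= (b - m) / 2.
  by rewrite /q !ge_min !lexx !orbT.
have small s x : 0 <= s <= q -> 0 <= x <= m + 1 -> `|twist (Delta s f) x| <= e / 2.
  move=> /andP[s0 sq] /andP[x0 xm]; apply: le_trans (norm_rot _ _) _.
  have : `|f (x + s) - f x| < e / 4.
    apply: Hr; rewrite /= ?in_itv/=; [apply/andP; split; lra|apply/andP; split; lra|].
    by rewrite addrC addKr ger0_norm//; lra.
  rewrite /Delta; lra.
have shiftE s x : twist (Delta s f) x = rot (- (2 * m * (x - m) + m ^+ 2))
   (twist (Delta (s + m) f) (x - m) - twist (Delta m f) (x - m)).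
  by rewrite -twist_Delta_shift rotK subrK.
have inab s : 0 <= s <= q -> [set s | a < s < b] (s + m).
  by move=> /andP[s0 sq] /=; apply/andP; split; lra.
(* The phase varies by [2 * m * |x - y|] and acts on a vector of norm at most [2 * K]; with the
   factor 2 of [dist_rot] this gives [8 * m * K]. *)
pose d' := Num.min 1 (Num.min d (e / 4 / (8 * m * K + 1))).
have mK : 0 <= 8 * m * K by apply: mulr_ge0 => //; lra.
exists q, d', (4 * K + e); split=> //.
  rewrite /d' !lt_min; apply/and3P; split=> //.
  by apply: divr_gt0; lra.
move=> s /= sq.
have [H1 B1] := H _ (inab _ sq); have [H2 B2] := H _ Hm.
split=> [x y Jx Jy|x Jx].
  rewrite /d' !lt_min => /and3P[xy1 xyd]; rewrite ltr_pdivlMr; last lra.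
  move=> xyK.
  have [[Jxm Jym]|nJ] := pselect (J (x - m) /\ J (y - m)).
    rewrite (shiftE s x) (shiftE s y); apply: le_trans (dist_rot _ _ _ _) _.
    have -> : - (2 * m * (x - m) + m ^+ 2) - - (2 * m * (y - m) + m ^+ 2) =
       - (2 * m) * (x - y) by ring.
    rewrite normrM normrN (ger0_norm (_ : 0 <= 2 * m)); last lra.
    have xym : `|x - m - (y - m)| < d by have -> : x - m - (y - m) = x - y by ring.
    have E1 : `|twist (Delta (s + m) f) (x - m) - twist (Delta m f) (x - m)| <= 2 * K.
      apply: le_trans (ler_normB _ _) _.
      by have := B1 _ Jxm; have := B2 _ Jxm; lra.
    have E2 : `|twist (Delta (s + m) f) (x - m) - twist (Delta m f) (x - m) -
       (twist (Delta (s + m) f) (y - m) - twist (Delta m f) (y - m))| <= e / 4.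
      rewrite subrACA; apply: le_trans (ler_normB _ _) _.
      by have := H1 _ _ Jxm Jym xym; have := H2 _ _ Jxm Jym xym; lra.
    have E3 : 2 * m * `|x - y| *
        `|twist (Delta (s + m) f) (x - m) - twist (Delta m f) (x - m)|
       <= 2 * m * `|x - y| * (2 * K).
      by apply: ler_wpM2l => //; apply: mulr_ge0 => //; lra.
    have E4 := normr_ge0 (x - y).
    lra.
  (* Here [J] is the half-line and one of the points is below [m]; since [d' <= 1], the other is
     below [m + 1]. *)
  have [x01 y01] : 0 <= x <= m + 1 /\ 0 <= y <= m + 1.
    move: nJ Jx Jy; case: hJ => -> /= nJ; last by case: nJ.
    move=> x0 y0; move: xy1; rewrite ltr_norml => /andP[xy1 xy2].
    have : x < m \/ y < m.
      have [xm|xm] := ltP x m; first by left.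
      have [ym|ym] := ltP y m; first by right.
      by exfalso; apply: nJ; split; lra.
    by clear -m0 x0 y0 xy1 xy2; case=> ?; split; apply/andP; split; lra.
  apply: le_trans (ler_normB _ _) _.
  by have := small _ _ sq x01; have := small _ _ sq y01; lra.
have [Jxm|nJ] := pselect (J (x - m)).
  rewrite shiftE; apply: le_trans (norm_rot _ _) _.
  have := ler_normB (twist (Delta (s + m) f) (x - m)) (twist (Delta m f) (x - m)).
  by have := B1 _ Jxm; have := B2 _ Jxm; lra.
have x01 : 0 <= x <= m + 1.
  move: nJ Jx; case: hJ => -> /= nJ; last by case: nJ.
  by move=> x0; apply/andP; split => //; have := nJ; lra.
by have := small _ _ sq x01; lra.
Qed.

(** By the cocycle identity the error is [e] from the phase, [2 * e] from the rotated increment and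
    [e] from the fixed function with parameter [r]. *)
Lemma equi_twist_shift A r d e K : 0 < r -> 0 < d -> 0 < e -> 0 <= K ->
  equi_twist A d e K ->
  exists d' K', 0 < d' /\ equi_twist [set s + r | s in A] d' (4 * e) K'.
Proof.
move=> r0 d0 e0 K0 H; have [dr dr0 Hr] := uf r0 e0; have [Kr HKr] := twist_Delta_bounded r0.
have rK : 0 <= 4 * r * K by apply: mulr_ge0 => //; lra.
exists (Num.min d (Num.min dr (e / (4 * r * K + 1)))), (Kr + 2 * K); split.
  rewrite !lt_min; apply/and3P; split=> //.
  by apply: divr_gt0; lra.
move=> _ [s /H[H1 B1] <-].
have shiftE x : twist (Delta (s + r) f) x = rot (2 * r * x + r ^+ 2)
   (twist (Delta s f) (x + r)) + twist (Delta r f) x.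
  by rewrite twist_Delta_shift subrK.
have Jr x : J x -> J (x + r) by move=> Jx; apply: domainD => //; exact: ltW.
split=> [x y Jx Jy|x Jx].
  rewrite !lt_min => /and3P[xyd xydr]; rewrite ltr_pdivlMr; last lra.
  move=> xyK; rewrite !shiftE subr_addACA; apply: le_trans (ler_normD _ _) _.
  have := dist_rot (2 * r * x + r ^+ 2) (2 * r * y + r ^+ 2)
     (twist (Delta s f) (x + r)) (twist (Delta s f) (y + r)).
  have -> : 2 * r * x + r ^+ 2 - (2 * r * y + r ^+ 2) = 2 * r * (x - y) by ring.
  rewrite normrM (ger0_norm (_ : 0 <= 2 * r)); last lra.
  have E1 : 2 * r * `|x - y| * `|twist (Delta s f) (x + r)| <= 2 * r * `|x - y| * K.
    by apply: ler_wpM2l; [apply: mulr_ge0 => //; lra|exact/B1/Jr].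
  have E2 : `|twist (Delta s f) (x + r) - twist (Delta s f) (y + r)| <= e.
    apply: (H1 _ _ (Jr _ Jx) (Jr _ Jy)).
    by have -> : x + r - (y + r) = x - y by ring.
  have := Hr _ _ Jx Jy xydr; have := normr_ge0 (x - y); lra.
rewrite shiftE; apply: le_trans (ler_normD _ _) _.
have := norm_rot (2 * r * x + r ^+ 2) (twist (Delta s f) (x + r)).
by have := B1 _ (Jr _ Jx); have := HKr _ Jx; lra.
Qed.

(** Each block of length [r] is obtained from the initial one by a single shift of [n.+1%:R * r].
    Shifting block after block would multiply the error by 4 each time; this way it stays at
    [4 * (e / 4)]. *)
Lemma equi_twist_segment h e : 0 < e -> exists d K, 0 < d /\
  equi_twist [set s | 0 <= s <= h] d e K.
Proof.
move=> e0; have e4 : 0 < e / 4 by lra.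
have [r [d [K [r0 d0 H]]]] := equi_twist_start e4.
have K0 : 0 <= K.
  have [|_ /(_ 0 (domain_ge0 hJ (lexx 0)))] := H 0; first by rewrite /= lexx ltW.
  exact: le_trans.
have step n : exists d K, 0 < d /\ equi_twist [set s | 0 <= s <= n.+1%:R * r] d e K.
  elim: n => [|n [d1 [K1 [d10 H1]]]].
    exists d, K; split=> //; apply: equi_twist_le H => //; last lra.
    by rewrite mul1r.
  have nr : 0 < n.+1%:R * r by apply: mulr_gt0.
  have [d2 [K2 [d20 H2]]] := equi_twist_shift nr d0 e4 K0 H.
  exists (Num.min d1 d2), (Num.max K1 K2); split; first by rewrite lt_min d10.
  move=> s /= /andP[s0 sn].
  have [sr|rs] := leP s (n.+1%:R * r).
    apply: (@equi_twist_le _ [set s] _ _ _ _ _ _ _ _ _ _ H1) => //.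
    - by move=> _ -> /=; rewrite s0.
    - by rewrite ge_min lexx.
    - by rewrite le_max lexx.
  apply: (@equi_twist_le _ [set s] _ _ _ _ _ _ _ _ _ _ H2) => //.
  - move=> _ -> /=; exists (s - n.+1%:R * r); last by rewrite subrK.
    by apply/andP; split; move: sn; rewrite -natr1; lra.
  - by rewrite ge_min lexx orbT.
  - lra.
  - by rewrite le_max lexx orbT.
have [d1 [K1 [d10 H1]]] := step (Num.truncn (h / r)).
exists d1, K1; split=> //; apply: equi_twist_le H1 => // s /= /andP[-> sh]/=.
apply: (le_trans sh); rewrite -ler_pdivrMr//.
by rewrite ltW// truncnS_gt.
Qed.

End TwistedDifferences.

(** * Means *)

Section RiemannMeans.
Set Implicit Arguments.
Unset Strict Implicit.
Context {R : realType}.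

Context {V : normedModType R}.
Implicit Types (F G : R -> V).

Lemma cvg_norm_le (u : nat -> V) (l : V) e : u n @[n --> \oo] --> l ->
  (\forall n \near \oo, `|u n| <= e) -> `|l| <= e.
Proof.
move=> ul ue; apply/ler_addgt0Pr => r r0.
move/cvgrPdist_le : ul => /(_ _ r0) ul.
have [n [lun une]] := @filter_ex _ \oo _ _ (filterI ul ue).
by have := ler_normD (l - u n) (u n); rewrite subrK; lra.
Qed.

Lemma riemann_mean_sub h n F G :
  riemann_mean h n F - riemann_mean h n G = riemann_mean h n (fun s => F s - G s).
Proof. by rewrite /riemann_mean -scalerBr sumrB. Qed.

Lemma riemann_mean_cst h n (v : V) : riemann_mean h n (fun=> v) = v.
Proof.
rewrite /riemann_mean sumr_const_nat subn0 -[v *+ _]scaler_nat scalerA mulVf ?scale1r//.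
Qed.

Lemma norm_riemann_mean h n F e : 0 <= h -> (forall s, 0 <= s <= h -> `|F s| <= e) ->
  `|riemann_mean h n F| <= e.
Proof.
move=> h0 Fe; have n0 : (0 : R) < n.+1%:R by [].
rewrite /riemann_mean normrZ ger0_norm ?invr_ge0// ler_pdivrMl//.
rewrite big_mkord; apply: le_trans (ler_norm_sum _ _ _) _.
apply: (@le_trans _ _ (\sum_(i < n.+1) e)); last first.
  by rewrite sumr_const card_ord mulr_natl.
apply: ler_sum => i _; apply: Fe; apply/andP; split.
  by rewrite mulr_ge0// divr_ge0.
rewrite mulrCA ler_piMr// ler_pdivrMr// mul1r ler_nat.
exact: ltnW.
Qed.

(** Two overlapping blocks differ only at their ends, in [j] terms on each side. This is the
    discrete form of the Lipschitz estimate for a moving average. *)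
Lemma sum_shift_sub (a : nat -> V) N j :
  \sum_(0 <= k < N) a (k + j)%N - \sum_(0 <= k < N) a k =
  \sum_(0 <= k < j) (a (N + k)%N - a k).
Proof.
elim: j => [|j IH].
  by rewrite big_nil; under eq_bigr do rewrite addn0; rewrite subrr.
rewrite big_nat_recr//= -IH.
rewrite -(subrKA (\sum_(0 <= k < N) a (k + j)%N)) addrC; congr (_ + _).
rewrite -sumrB; under eq_bigr do rewrite addnS -addSn.
by rewrite (@telescope_sumr _ _ _ (fun k => a (k + j)%N)).
Qed.

Lemma norm_riemann_mean_shift h n F M j : 0 < h -> (forall s, 0 <= s -> `|F s| <= M) ->
  `|riemann_mean h n (fun s => F (j%:R * (h / n.+1%:R) + s)) - riemann_mean h n F| <=
  2 * M * (j%:R / n.+1%:R).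
Proof.
move=> h0 FM; have n0 : (0 : R) < n.+1%:R by [].
rewrite /riemann_mean -scalerBr.
under [X in X - _]eq_bigr => k _.
  have -> : j%:R * (h / n.+1%:R) + k%:R * (h / n.+1%:R) =
    (k + j)%N%:R * (h / n.+1%:R) by rewrite natrD mulrDl addrC.
  over.
rewrite (sum_shift_sub (fun k => F (k%:R * (h / n.+1%:R)))).
rewrite normrZ ger0_norm ?invr_ge0// ler_pdivrMl//.
have -> : n.+1%:R * (2 * M * (j%:R / n.+1%:R)) = j%:R * (2 * M) :> R.
  by field; rewrite addrC natr1 gt_eqF.
rewrite big_mkord; apply: le_trans (ler_norm_sum _ _ _) _.
apply: (@le_trans _ _ (\sum_(i < j) (2 * M))); last first.
  by rewrite sumr_const card_ord [j%:R * _]mulr_natl.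
apply: ler_sum => i _; apply: le_trans (ler_normB _ _) _.
have P k : 0 <= k%:R * (h / n.+1%:R) by rewrite mulr_ge0// divr_ge0// ltW.
by have := FM _ (P (n.+1 + i)%N); have := FM _ (P i); lra.
Qed.

End RiemannMeans.

Section Means.
Set Implicit Arguments.
Unset Strict Implicit.
Context {R : realType} (J : set R).
Hypothesis hJ : J = [set t : R | 0 <= t] \/ J = [set: R].

Lemma cont_on_L1loc {V : normedModType R} (g : R -> V) : cont_on J g -> L1loc J g.
Proof.
move=> cg a b ab abJ; apply: bochner_integrable_unif => //.
exact: cont_on_uniform cg.
Qed.

Context {X : completeNormedModType R}.
Implicit Types (g : R -> X * X).

Lemma cvg_Mean g h t : cont_on J g -> 0 < h -> J t ->
  riemann_mean h n (fun s => g (t + s)) @[n --> \oo] --> Mean h g t.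
Proof.
move=> cg h0 Jt; apply: cvg_riemann_mean => //.
apply: (@cont_on_uniform _ _ `[0, h]%classic) => // x /=; rewrite in_itv/= => /andP[x0 _] e e0.
have [d d0 Hd] := cg _ (domainD hJ Jt x0) _ e0.
exists d => // y /=; rewrite in_itv/= => /andP[y0 _] xy.
by apply: Hd; [exact: domainD|rewrite subr_addACA subrr add0r].
Qed.

Lemma Delta_Mean g h r t : cont_on J g -> 0 < h -> 0 <= r -> J t ->
  Delta r (Mean h g) t = Mean h (Delta r g) t.
Proof.
move=> cg h0 r0 Jt.
have H1 := cvg_Mean cg h0 (domainD hJ Jt r0).
have H2 := cvg_Mean cg h0 Jt.
have cD : cont_on J (Delta r g) by apply: cont_on_sub => //; exact: cont_on_shift.
have H3 := cvg_Mean cD h0 Jt.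
apply: (cvg_unique _ _ H3) => //.
have -> : (fun n => riemann_mean h n (fun s => Delta r g (t + s))) =
    (fun n => riemann_mean h n (fun s => g (t + r + s)) -
              riemann_mean h n (fun s => g (t + s))).
  apply/funext => n; rewrite riemann_mean_sub; congr riemann_mean.
  by apply/funext => s; rewrite /Delta addrAC.
exact: (cvgB H1 H2).
Qed.

(** The mean of a function bounded by [M] is Lipschitz with constant [2 * M / h]. On Riemann sums, a
    shift by [r] is split into [j] whole grid steps, which cost boundary terms only, and a remainder
    below the mesh, absorbed by uniform continuity of [g] on a segment. *)
Lemma UC_Mean g h M : cont_on J g -> (forall t, J t -> `|g t| <= M) -> 0 < h ->
  UC J (Mean h g).
Proof.
move=> cg gM h0 e e0.
have M0 : 0 <= M by apply: le_trans (gM 0 (domain_ge0 hJ (lexx 0))).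
have [d d0 Hd] : exists2 d, 0 < d & 2 * M * d / h <= e / 4.
  exists (e * h / 8 / (M + 1)); first by rewrite !divr_gt0 ?mulr_gt0//; lra.
  rewrite ler_pdivrMr// mulrA ler_pdivrMr; last lra.
  have : 0 <= e * h by apply: mulr_ge0; lra.
  nra.
have main x r : J x -> 0 <= r < d -> `|Mean h g (x + r) - Mean h g x| <= e / 2.
  move=> Jx /andP[r0 rd].
  apply: (cvg_norm_le (cvgB (cvg_Mean cg h0 (domainD hJ Jx r0)) (cvg_Mean cg h0 Jx))).
  have sub : `[x, x + r + h]%classic `<=` J.
    move=> y /=; rewrite in_itv/= => /andP[xy _].
    by rewrite (_ : y = x + (y - x)); [apply: domainD => //; lra|ring].
  have e4 : 0 < e / 4 by lra.
  have [q q0 Hq] := cont_on_uniform sub cg e4.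
  have : h / n.+1%:R @[n --> \oo] --> (0 : R).
    by rewrite -[X in _ --> X](mulr0 h); apply: cvgMr; exact: cvg_harmonic.
  move/cvgrPdist_lt/(_ _ q0); apply: filterS => n.
  have n0 : (0 : R) < n.+1%:R by [].
  set p := h / n.+1%:R; have p0 : 0 < p by exact: divr_gt0.
  rewrite sub0r normrN gtr0_norm// => pq.
  have /truncn_itv : 0 <= r / p by rewrite divr_ge0// ltW.
  set j := Num.truncn _; rewrite ler_pdivlMr// ltr_pdivrMr// -natr1 => /andP[j1 j2].
  have jp0 : 0 <= j%:R * p by apply: mulr_ge0 => //; exact: ltW.
  have B1 : `|riemann_mean h n (fun s => g (x + (j%:R * p + s))) -
             riemann_mean h n (fun s => g (x + s))| <= 2 * M * (j%:R / n.+1%:R).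
    apply: (@norm_riemann_mean_shift _ _ _ _ (fun s => g (x + s))) => // s s0.
    by apply: gM; exact: domainD.
  have B2 : `|riemann_mean h n (fun s => g (x + r + s)) -
             riemann_mean h n (fun s => g (x + (j%:R * p + s)))| <= e / 4.
    rewrite riemann_mean_sub; apply: norm_riemann_mean; first exact: ltW.
    move=> s /andP[s0 sh]; apply/ltW/Hq; rewrite /= ?in_itv/=.
    - by apply/andP; split; lra.
    - by apply/andP; split; lra.
    - have -> : x + r + s - (x + (j%:R * p + s)) = r - j%:R * p by ring.
      by rewrite ger0_norm; lra.
  have B3 : 2 * M * (j%:R / n.+1%:R) <= e / 4.
    apply: le_trans Hd; rewrite -[leRHS]mulrA; apply: ler_wpM2l; first lra.
    rewrite ler_pdivlMr// mulrAC -mulrA -/p; lra.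
  apply: le_trans (ler_distD (riemann_mean h n (fun s => g (x + (j%:R * p + s)))) _ _) _.
  by apply: le_trans (lerD B2 (le_trans B1 B3)) _; lra.
exists d => // x y Jx Jy xy; apply: (@le_lt_trans _ _ (e / 2)); last lra.
have close a b : J a -> a <= b -> `|a - b| < d -> `|Mean h g b - Mean h g a| <= e / 2.
  move=> Ja ab; rewrite distrC ger0_norm ?subr_ge0// => ba.
  have Eb : a + (b - a) = b by ring.
  have := main a (b - a) Ja; rewrite Eb; apply.
  by rewrite subr_ge0 ab.
have [le_xy|/ltW le_yx] := leP x y; last by apply: close => //; rewrite distrC.
by rewrite distrC; exact: close.
Qed.

End Means.

Section MeanDecomposition.
Set Implicit Arguments.
Unset Strict Implicit.
Context {R : realType} (J : set R).
Hypothesis hJ : J = [set t : R | 0 <= t] \/ J = [set: R].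
Context {X : completeNormedModType R}.

Lemma distrNN (a b : X * X) : `|- a - - b| = `|a - b|.
Proof. by rewrite opprK addrC distrC. Qed.

Lemma cvg_rot a (u : nat -> X * X) l :
  u n @[n --> \oo] --> l -> rot a (u n) @[n --> \oo] --> rot a l.
Proof.
move=> /cvgrPdist_le ul; apply/cvgrPdist_le => e e0.
have e2 : 0 < e / 2 by lra.
have := ul _ e2; apply: filterS => n H; rewrite -rotB.
by apply: le_trans (norm_rot _ _) _; lra.
Qed.

(* The phase of chirp flips between t and t' with t'^2 = t^2 + pi, so a
   uniformly continuous function in chirp * UC is small far from 0. *)
Lemma UC_twist_vanishes (g : R -> X * X) : UC J g -> UC J (twist g) -> C0 J g.
Proof.
move=> ug uW; split; first exact/cont_on_within/UC_cont.
move=> e e0; have e8 : 0 < e / 8 by lra.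
have [d1 d10 H1] := ug _ e8; have [d2 d20 H2] := uW _ e8.
have d0 : 0 < Num.min d1 d2 by rewrite lt_min d10.
have [T T0 HT] := exists_sqr_add_pi d0.
exists T => t Jt /HT[t' [t'2]]; rewrite lt_min => /andP[td1 td2] t'0.
have Jt' : J t' by move: Jt; case: hJ => -> //=.
have G1 := H1 _ _ Jt Jt' td1; have G2 := H2 _ _ Jt Jt' td2.
have G3 : `|g t + g t'| <= 2 * (e / 8).
  rewrite -(twistK g t) -(twistK g t') t'2 rotDpi -rotB.
  by apply: le_trans (norm_rot _ _) _; lra.
have : `|2%:R *: g t| <= `|g t - g t'| + `|g t + g t'|.
  apply: le_trans (ler_normD _ _); rewrite scaler_nat mulr2n addrACA addNr addr0.
  exact: lexx.
rewrite normrZ ger0_norm//; lra.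
Qed.

Lemma BUC_twist_Delta (g : R -> X * X) r : 0 <= r -> BUC J (twist g) ->
  BUC J (twist (Delta r g)).
Proof.
move=> r0 bg.
have := BUC_sub (BUC_rot hJ (2 * r) (r ^+ 2) (BUC_shift hJ r0 bg)) bg.
apply: BUC_eq => t Jt; rewrite /twist rotD /Delta rotB.
by congr (rot _ _ - _); ring.
Qed.

Context (f : R -> X * X).
Hypothesis uf : forall s, 0 < s -> UC J (twist (Delta s f)).

Let cf : cont_on J f := cont_on_of_twisted_differences hJ uf.

(** For fixed [t] the angle is constant, so rotation and subtraction of [f t] commute with the
    averages over [s]. *)
Lemma cvg_twist_Mean h t : 0 < h -> J t ->
  riemann_mean h n (fun s => twist (Delta s f) t) @[n --> \oo] -->
  - twist (fun x => f x - Mean h f x) t.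
Proof.
move=> h0 Jt; have H := cvg_rot (a := - t ^+ 2) (cvg_Mean hJ cf h0 Jt).
have -> : (fun n => riemann_mean h n (fun s => twist (Delta s f) t)) =
    (fun n => rot (- t ^+ 2) (riemann_mean h n (fun s => f (t + s))) -
      rot (- t ^+ 2) (f t)).
  apply/funext => n; rewrite -rotB -[in RHS](riemann_mean_cst h n (f t)).
  by rewrite riemann_mean_sub /riemann_mean rotZ rot_sum.
have -> : - twist (fun x => f x - Mean h f x) t =
    rot (- t ^+ 2) (Mean h f t) - rot (- t ^+ 2) (f t).
  by rewrite /twist rotB opprB.
exact: (cvgB H (cvg_cst _)).
Qed.

Lemma BUC_twist_sub_Mean h : 0 < h -> BUC J (twist (fun t => f t - Mean h f t)).
Proof.
move=> h0; split.
  move=> e e0; have e2 : 0 < e / 2 by lra.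
  (* The averages sample [s = 0] as well, hence estimates on the closed segment; averages and their
     limits inherit the common modulus. *)
  have [d [K [d0 H]]] := equi_twist_segment hJ uf h e2.
  exists d => // x y Jx Jy xy; apply: (@le_lt_trans _ _ (e / 2)); last lra.
  rewrite -distrNN.
  apply: (cvg_norm_le (cvgB (cvg_twist_Mean h0 Jx) (cvg_twist_Mean h0 Jy))).
  apply: nearW => n.
  suff B : `|riemann_mean h n (fun s => twist (Delta s f) x) -
      riemann_mean h n (fun s => twist (Delta s f) y)| <= e / 2 by exact: B.
  rewrite riemann_mean_sub; apply: norm_riemann_mean; first exact: ltW.
  by move=> s sh; apply: (H s sh).1.
have [d [K [d0 H]]] := equi_twist_segment hJ uf h (@ltr01 R).
exists K => t Jt; rewrite -normrN; apply: (cvg_norm_le (cvg_twist_Mean h0 Jt)).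
apply: nearW => n; apply: norm_riemann_mean; first exact: ltW.
by move=> s sh; exact: (H s sh).2.
Qed.

Lemma cont_on_Mean h : 0 < h -> cont_on J (Mean h f).
Proof.
move=> h0; have [uW _] := BUC_twist_sub_Mean h0.
have := cont_on_sub cf (twist_cont uW).
by apply: cont_on_eq => t _; rewrite subKr.
Qed.

(** Although [f] may be unbounded, [Delta r f] is bounded, so its mean, which is the difference of
    [Mean h f], is uniformly continuous. The twist of that difference is uniformly continuous too,
    since those of [f] and of [f - Mean h f] are; [UC_twist_vanishes] concludes. *)
Lemma Mean_DeltaC0 h : 0 < h -> DeltaC0 J (Mean h f).
Proof.
move=> h0; split; first exact/cont_on_L1loc/cont_on_Mean.
move=> r r0; have [K HK] := twist_Delta_bounded hJ uf r0.
apply: UC_twist_vanishes.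
  have : UC J (Mean h (Delta r f)).
    apply: (@UC_Mean _ _ hJ _ _ _ (2 * K)) => //; first exact: Delta_cont.
    by move=> t Jt; apply: le_trans (norm_rot_ge (- t ^+ 2) _) _; rewrite ler_pM2l// HK.
  by apply: UC_eq => t Jt; rewrite (Delta_Mean hJ)// ltW.
have bD := BUC_twist_Delta (ltW r0) (BUC_twist_sub_Mean h0).
apply: (UC_eq _ (UC_sub (uf r0) bD.1)) => t Jt.
rewrite /twist -rotB; congr rot; rewrite /Delta subrACA.
by rewrite !subKr.
Qed.

End MeanDecomposition.

Theorem theorem3p7 (R : realType) (X : completeNormedModType R) (J : set R)
    (hJ : J = [set t : R | 0 <= t] \/ J = [set: R])
    (f : R -> X * X)
    (hf : forall s : R, 0 < s -> mul_space J chirp (UC J) (Delta s f)) :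
  [/\ (* (i) *)
      sum_space J (mul_space J chirp (BUC J)) (DeltaC0 J) f /\
        (forall s : R, 0 < s -> mul_space J chirp (BUC J) (Delta s f)),
      (* (ii) *)
      forall h : R, 0 < h -> DeltaC0 J (Mean h f) &
      (* (iii) *)
      has_Delta J (mul_space J chirp (BUC J) : set (R -> X * X)) /\
        has_Delta J (mul_space J chirp (UC J) : set (R -> X * X))].
Proof.
have uf s : 0 < s -> UC J (twist (Delta s f)) by move=> /hf/mul_space_UCP.
have BUC_L1loc : mul_space J chirp (BUC J) `<=` (L1loc J : set (R -> X * X)).
  by move=> g /mul_space_BUCP[ug _]; apply: cont_on_L1loc; exact: twist_cont.
have UC_L1loc : mul_space J chirp (UC J) `<=` (L1loc J : set (R -> X * X)).
  by move=> g /mul_space_UCP ug; apply: cont_on_L1loc; exact: twist_cont.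
split.
- split.
    (* Any positive width would do in place of 1. *)
    exists (fun t => f t - Mean 1 f t), (Mean 1 f); split.
    + exact/mul_space_BUCP/BUC_twist_sub_Mean.
    + exact: Mean_DeltaC0.
    + by move=> t _; rewrite subrK.
  move=> s s0; apply/mul_space_BUCP; split; first exact: uf.
  exact: twist_Delta_bounded.
- by move=> h h0; exact: Mean_DeltaC0.
(* Both cases rerun the argument for [g]: differences in either space have uniformly continuous
   twists, and [g - Mean h g] then has even a bounded one. *)
- split; split=> // g _ hg h h0.
    apply/mul_space_BUCP/BUC_twist_sub_Mean => // s s0.
    by have /mul_space_BUCP[] := hg s s0.
  have ug s : 0 < s -> UC J (twist (Delta s g)) by move=> /hg/mul_space_UCP.
  by apply/mul_space_UCP; have [] := BUC_twist_sub_Mean hJ ug h0.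
Qed.
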